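(* Let $m$ be a fixed number of machines. There exists a fully polynomial-time approximation scheme (FPTAS) for $Fm|reentry,\ p_{ijk}=1|\sum w_jC_j$, i.e., for the problem of minimizing the total weighted completion time in a reentrant flow shop with $m$ machines and unit processing times.
   Context: Reentrant flow shop with unit processing times: there are $m\ge 1$ machines in series and $n$ jobs. Job $j$ must traverse the shop $\mathcal{L}_j\ge 1$ times (loops $k=1,\dots,\mathcal{L}_j$, with $\mathcal{L}_j$ an integer) and has weight $w_j>0$. In each loop it is processed for one time unit on each of the machines $1,2,\dots,m$ in this order. Once a loop is started on machine $1$ it proceeds through all machines without waiting. A schedule is an assignment of start times $S_{jk}\in\{0,1,2,\dots\}$ on machine $1$ to all loops $(j,k)$ such that distinct loops have distinct start times and $S_{jk}\ge C_{j,k-1}$ for $k\ge 2$, where $C_{jk}=S_{jk}+m$ is the completion time of loop $k$ of job $j$ on machine $m$. The completion time of job $j$ is $C_j=C_{j\mathcal{L}_j}$, and the objective is to minimize $\sum_{j=1}^n w_jC_j$. The number $m$ is a constant and not part of the input. An FPTAS is a family of algorithms, one for each $\varepsilon>0$, such that the algorithm for $\varepsilon$ outputs for each instance a schedule with objective value at most $(1+\varepsilon)$ times the optimal objective value, and whose runtime is polynomial in the size of the input and in $1/\varepsilon$. (Input numbers are encoded in binary; a schedule in which each job's loops are processed consecutively without interruption, i.e. $S_{jk}=C_{j,k-1}$ for all $k\ge 2$, may be output compactly by giving the start time of the first loop of each job.) *)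

(* Defs.v *)
From mathcomp Require Import all_boot all_order all_algebra.
From mathcomp Require Import reals.

Set Implicit Arguments.
Unset Strict Implicit.
Unset Printing Implicit Defensive.

Import Order.TTheory GRing.Theory Num.Theory.

(** Model of computation

    A first-order, call-by-value functional language over S-expressions whose
    atoms are natural numbers, with the logarithmic cost criterion of
    Aho-Hopcroft-Ullman random access machines: an arithmetic instruction or a
    literal costs the number of bits of its operands, and every other
    instruction (variable access, allocation of a pair, projection, zero test,
    binding, call) costs 1.  Up to polynomial factors this is Turing machine
    time: values are shared heap objects, and the total number of bits ever
    produced is linear in the cost. *)

Inductive val := Num of nat | Pair of val & val.

(* Length of the binary representation; bitlen 0 = 1. *)
Definition bitlen (n : nat) : nat := (trunc_log 2 n).+1.

Fixpoint vsize (v : val) : nat :=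
  match v with
  | Num n => bitlen n
  | Pair a b => (vsize a + vsize b).+1
  end.

Inductive binop := Add | Sub | Mul | Div | Leq.

(* Sub is truncated, Div is Euclidean with Div a 0 = 0. *)
Definition binop_sem (o : binop) (a b : nat) : nat :=
  match o with
  | Add => a + b
  | Sub => a - b
  | Mul => a * b
  | Div => a %/ b
  | Leq => (a <= b : bool)
  end.

(* Var i is a de Bruijn index; Call f e applies the f-th function of the
   program to the value of e. *)
Inductive expr :=
  | Var of nat
  | Lit of nat
  | Op of binop & expr & expr
  | MkPair of expr & expr
  | Fst of expr
  | Snd of expr
  | If of expr & expr & expr
  | Let of expr & expr
  | Call of nat & expr.

(* The list of the bodies of the (mutually recursive, unary) functions;
   the entry point is function 0. *)
Definition program := seq expr.

Definition is_zero (v : val) : bool := if v is Num 0 then true else false.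

(* eval P env e v c : in environment env the expression e evaluates to v at
   cost c.  Ill-typed and diverging evaluations have no derivation. *)
Inductive eval (P : program) : seq val -> expr -> val -> nat -> Prop :=
  | EVar env i : i < size env -> eval P env (Var i) (nth (Num 0) env i) 1
  | ELit env n : eval P env (Lit n) (Num n) (bitlen n)
  | EOp env o e1 e2 a b c1 c2 :
      eval P env e1 (Num a) c1 -> eval P env e2 (Num b) c2 ->
      eval P env (Op o e1 e2) (Num (binop_sem o a b))
        (c1 + c2 + (bitlen a + bitlen b))
  | EMkPair env e1 e2 v1 v2 c1 c2 :
      eval P env e1 v1 c1 -> eval P env e2 v2 c2 ->
      eval P env (MkPair e1 e2) (Pair v1 v2) (c1 + c2).+1
  | EFst env e v1 v2 c :
      eval P env e (Pair v1 v2) c -> eval P env (Fst e) v1 c.+1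
  | ESnd env e v1 v2 c :
      eval P env e (Pair v1 v2) c -> eval P env (Snd e) v2 c.+1
  | EIf env e e1 e2 b v c1 c2 :
      eval P env e b c1 -> eval P env (if is_zero b then e2 else e1) v c2 ->
      eval P env (If e e1 e2) v (c1 + c2).+1
  | ELet env e1 e2 v1 v2 c1 c2 :
      eval P env e1 v1 c1 -> eval P (v1 :: env) e2 v2 c2 ->
      eval P env (Let e1 e2) v2 (c1 + c2).+1
  | ECall env f e v1 v2 c1 c2 :
      eval P env e v1 c1 -> f < size P ->
      eval P [:: v1] (nth (Lit 0) P f) v2 c2 ->
      eval P env (Call f e) v2 (c1 + c2).+1.

Lemma eval_det (P : program) env e v c v' c' :
  eval P env e v c -> eval P env e v' c' -> v = v' /\ c = c'.
Proof.
move=> ev; elim: ev v' c' => {env e v c}.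
- by move=> env i _ v' c' ev; inversion ev.
- by move=> env n v' c' ev; inversion ev.
- move=> env o e1 e2 a b c1 c2 _ IH1 _ IH2 v' c' ev; inversion ev; subst.
  by have [[->] ->] := IH1 _ _ ltac:(eassumption);
     have [[->] ->] := IH2 _ _ ltac:(eassumption).
- move=> env e1 e2 v1 v2 c1 c2 _ IH1 _ IH2 v' c' ev; inversion ev; subst.
  by have [-> ->] := IH1 _ _ ltac:(eassumption);
     have [-> ->] := IH2 _ _ ltac:(eassumption).
- move=> env e v1 v2 c _ IH v' c' ev; inversion ev; subst.
  by have [[-> _] ->] := IH _ _ ltac:(eassumption).
- move=> env e v1 v2 c _ IH v' c' ev; inversion ev; subst.
  by have [[_ ->] ->] := IH _ _ ltac:(eassumption).
- move=> env e e1 e2 b v c1 c2 _ IH1 _ IH2 v' c' ev; inversion ev; subst.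
  have [eb ec] := IH1 _ _ ltac:(eassumption); subst.
  by have [-> ->] := IH2 _ _ ltac:(eassumption).
- move=> env e1 e2 v1 v2 c1 c2 _ IH1 _ IH2 v' c' ev; inversion ev; subst.
  have [eb ec] := IH1 _ _ ltac:(eassumption); subst.
  by have [-> ->] := IH2 _ _ ltac:(eassumption).
- move=> env f e v1 v2 c1 c2 _ IH1 _ _ IH2 v' c' ev; inversion ev; subst.
  have [eb ec] := IH1 _ _ ltac:(eassumption); subst.
  by have [-> ->] := IH2 _ _ ltac:(eassumption).
Qed.

(* On input x the program P halts with output y after time t.  The time
   includes writing out y, since a value with sharing may be much larger than
   the cost of building it. *)
Definition runs (P : program) (x y : val) (t : nat) : Prop :=
  exists2 c : nat, eval P [:: x] (Call 0 (Var 0)) y c & t = c + vsize y.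

Definition enc_seq (s : seq val) : val := foldr Pair (Num 0) s.

(* enc_sol is a relation because a solution may have several admissible
   encodings, or none. *)
Record min_problem := MinProblem {
  inst : Type;
  sol : inst -> Type;
  enc_inst : inst -> val;
  enc_sol : forall I : inst, sol I -> val -> Prop;
  feasible : forall I : inst, sol I -> Prop;
  objective : forall I : inst, sol I -> rat
}.

Section Fptas.
Local Open Scope ring_scope.

Definition is_optimum (pb : min_problem) (I : inst pb) (v : rat) : Prop :=
  (exists2 S : sol I, feasible S & objective S = v) /\
  (forall S : sol I, feasible S -> v <= objective S).

Definition has_fptas (R : realType) (pb : min_problem) : Prop :=
  exists p : {poly {poly R}},
  forall eps : R, 0 < eps ->
  exists P : program,
  forall I : inst pb,
  exists (y : val) (t : nat) (S : sol I) (opt : rat),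
    [/\ runs P (enc_inst I) y t,
        t%:R <= p.[((vsize (enc_inst I))%:R)%:P].[eps^-1],
        enc_sol S y /\ feasible S,
        is_optimum I opt
      & ratr (objective S) <= (1 + eps) * ratr opt].

End Fptas.

Record rfs_inst := RfsInst {
  njobs : nat;
  loops : 'I_njobs -> nat;
  weight : 'I_njobs -> rat;
  loops_gt0 : forall j, 0 < loops j;
  weight_gt0 : forall j, (0 < weight j)%R
}.

(* S j k is the start time of loop k of job j on machine 1; loops are numbered
   1, ..., loops j, and the other values of S are irrelevant. *)
Definition schedule (I : rfs_inst) : Type := 'I_(njobs I) -> nat -> nat.

Section ReentrantFlowShop.
Variables (m : nat) (I : rfs_inst).
Implicit Type S : schedule I.

Definition is_loop (j : 'I_(njobs I)) (k : nat) : bool := 1 <= k <= loops j.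

Definition loop_completion S (j : 'I_(njobs I)) (k : nat) : nat := S j k + m.

Definition rfs_feasible S : Prop :=
  (forall j k j' k', is_loop j k -> is_loop j' k' ->
     S j k = S j' k' -> j = j' /\ k = k') /\
  (forall j k, is_loop j k -> 2 <= k -> loop_completion S j k.-1 <= S j k).

Definition completion S (j : 'I_(njobs I)) : nat := loop_completion S j (loops j).

Definition rfs_objective S : rat :=
  (\sum_(j < njobs I) weight j * (completion S j)%:R)%R.

Definition uninterrupted S : Prop :=
  forall j k, is_loop j k -> 2 <= k -> S j k = loop_completion S j k.-1.

(* A schedule is output either explicitly (tag 0), or, if no job is
   interrupted, by the start times of the first loops (tag 1). *)
Inductive rfs_enc_sol S : val -> Prop :=
  | EncExplicit :
      rfs_enc_sol S (Pair (Num 0)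
        (enc_seq [seq enc_seq [seq Num (S j k) | k <- iota 1 (loops j)]
                 | j <- enum 'I_(njobs I)]))
  | EncCompact : uninterrupted S ->
      rfs_enc_sol S (Pair (Num 1)
        (enc_seq [seq Num (S j 1) | j <- enum 'I_(njobs I)])).

End ReentrantFlowShop.

(* A weight is encoded by its numerator and denominator in lowest terms. *)
Definition rfs_enc_inst (I : rfs_inst) : val :=
  enc_seq [seq Pair (Num (loops j))
                 (Pair (Num (absz (numq (weight j)))) (Num (absz (denq (weight j)))))
          | j <- enum 'I_(njobs I)].

(* The number m of machines is a parameter of the problem, not of its input. *)
Definition reentrant_flow_shop (m : nat) : min_problem :=
  {| inst := rfs_inst;
     sol := schedule;
     enc_inst := rfs_enc_inst;
     enc_sol := @rfs_enc_sol m;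
     feasible := @rfs_feasible m;
     objective := @rfs_objective m |}.

(* Main.v *)
Require Import Defs.
From mathcomp Require Import all_boot all_order all_algebra.
From mathcomp Require Import reals.
From mathcomp Require Import zify lra.

Import Defs.

Set Implicit Arguments.
Unset Strict Implicit.
Unset Printing Implicit Defensive.

Import Order.TTheory GRing.Theory Num.Theory.

(** Seen from machine 1, a loop started at time t occupies the interval
    [t, t + m), and since start times are distinct at most min (s + 1) m loops
    are in progress at time s.  So every schedule of the shop is a preemptive
    schedule of jobs of length m * loops j on m identical parallel machines,
    machine r being available from time r on, with the same completion times.
    Conversely, if a job is run without interruption on machine r behind
    uninterrupted jobs, then it starts at a time congruent to r modulo m, and its
    loops can be started every m time units in the shop without colliding with
    those of another machine.  Preemption does not help to minimize the total
    weighted completion time on parallel machines (McNaughton), even with these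
    staggered availabilities: this is [nonpreemptive_wins], proved by going back
    in time one unit at a time, the exchange argument being [absorb1].  Hence some
    optimal schedule is given by an assignment of the jobs to the machines, each
    machine processing its jobs in Smith's order ([schedule_ge_assignment]).

    For this assignment problem, dynamic programming treats the jobs in Smith's
    order; a state consists of the cost so far and the m machine loads.  A new
    state is discarded when some retained state is at most 1 + 1/N times as large
    in each coordinate.  One such step multiplies the error by 1 + 1/N, because
    cost and loads depend monotonically on earlier states, so with
    N = n (K + 1) + 1 the final error is at most (1 + 1/N)^n <= 1 + 1/K
    ([dp_near_optimal], [ratio_pow_le]).  Two retained states never lie in the
    same cell of a geometric grid of ratio 1 + 1/N, which leaves at
    most (N b + 1)^(m + 1) states when the coordinates have b bits
    ([antichain_size]).  Rational weights are first multiplied by the product of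
    their denominators, which has polynomial bit length.

    The algorithm is written out in the machine language as [prog]; for each of
    its functions, one lemma gives the result and a bound on the cost.  The
    total cost is polynomial in the input size and in K, and K is the least
    integer greater than 1/eps. *)

(** * Nonpreemptive schedules on staggered parallel machines are optimal *)

Section LowerBound.
Variables (J : finType) (w : J -> nat) (m : nat).
Implicit Types (p : J -> nat) (l : seq J) (a : 'I_m -> nat) (L : 'I_m -> seq J).

(** Weighted completion time of the jobs of l run in this order from time t on,
    p being the remaining lengths. *)
Fixpoint wct p (t : nat) l : nat :=
  if l is j :: l' then w j * (t + p j) + wct p (t + p j) l' else 0.

Definition tail_weight l := \sum_(j <- l) w j.

Lemma wct_cat p t l1 l2 :
  wct p t (l1 ++ l2) = wct p t l1 + wct p (t + \sum_(j <- l1) p j) l2.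
Proof.
elim: l1 t => [|j l1 IH] t /=; first by rewrite big_nil addn0.
by rewrite IH big_cons !addnA.
Qed.

Lemma wct_delay p t d l : wct p (t + d) l = wct p t l + d * tail_weight l.
Proof.
elim: l t => [|j l IH] t /=; first by rewrite /tail_weight big_nil muln0.
rewrite /tail_weight big_cons -/(tail_weight l) addnAC IH; nia.
Qed.

Lemma leq_wct p t t' l : t <= t' -> wct p t l <= wct p t' l.
Proof. by move=> /subnKC <-; rewrite wct_delay leq_addr. Qed.

Lemma eq_wct p p' t l : {in l, p =1 p'} -> wct p t l = wct p' t l.
Proof.
elim: l t => //= j l IH t e; rewrite e ?mem_head // IH // => i il.
by apply: e; rewrite inE il orbT.
Qed.

Definition add_unit p j i := p i + (i == j).

Lemma wct_add_unit_notin p j t l : j \notin l -> wct (add_unit p j) t l = wct p t l.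
Proof.
move=> jl; apply: eq_wct => i il; rewrite /add_unit.
by case: eqP => [e|]; [rewrite e in il; rewrite il in jl | rewrite addn0].
Qed.

Lemma wct_add_unit_cons p j t l :
  j \notin l -> wct (add_unit p j) t (j :: l) = wct p t.+1 (j :: l).
Proof.
by move=> jl /=; rewrite wct_add_unit_notin // /add_unit eqxx addn1 addnS addSn.
Qed.

(** Counting occurrences over all machines makes this insensitive to moving jobs from
    one list to another. *)
Definition arranged L p := forall j, \sum_r count_mem j (L r) = (0 < p j).
Definition total_wct p a L := \sum_r wct p (a r) (L r).

Lemma leq_sum_but1 (F G : 'I_m -> nat) M c :
  (forall r, r != M -> F r <= G r) -> F M <= G M + c -> \sum_r F r <= \sum_r G r + c.
Proof.
move=> h hM; rewrite (bigD1 M) //= [X in _ <= X + c](bigD1 M) //=.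
have : \sum_(r | r != M) F r <= \sum_(r | r != M) G r by apply: leq_sum.
by move=> k; rewrite addnAC leq_add.
Qed.

Lemma leq_sum_but2 (F G : 'I_m -> nat) M N c : M != N ->
  (forall r, r != M -> r != N -> F r <= G r) -> F M + F N <= G M + G N + c ->
  \sum_r F r <= \sum_r G r + c.
Proof.
move=> MN h hM; rewrite (bigD1 M) //= [X in _ <= X + c](bigD1 M) //=.
rewrite (bigD1 N) 1?eq_sym //= [X in _ <= _ + X + c](bigD1 N) 1?eq_sym //=.
have : \sum_(r | (r != M) && (r != N)) F r <= \sum_(r | (r != M) && (r != N)) G r.
  by apply: leq_sum => r /andP [rM rN]; apply: h.
by move=> k; rewrite !addnA [X in _ <= X]addnAC leq_add.
Qed.

Lemma arranged_count L p r j : arranged L p -> count_mem j (L r) <= (0 < p j).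
Proof. by move=> <-; rewrite (bigD1 r) //= leq_addr. Qed.

Lemma arranged_uniq L p r : arranged L p -> uniq (L r).
Proof.
move=> ar; apply/count_mem_uniq => j; rewrite -has_pred1 has_count.
have := arranged_count r j ar; case: (count_mem _ _) => [|[|c]] //.
by case: (0 < p j).
Qed.

Lemma arranged_pos L p r j : arranged L p -> j \in L r -> 0 < p j.
Proof.
move=> ar; rewrite -has_pred1 has_count => /leq_trans /(_ (arranged_count r j ar)).
by case: (0 < p j).
Qed.

Lemma arranged_mem L p j : arranged L p -> 0 < p j -> exists r, j \in L r.
Proof.
move=> /(_ j) e pj; apply/existsP; apply: contraPT e => /existsPn no.
rewrite pj big1 // => r _; apply/count_memPn; exact: no.
Qed.

Lemma arranged_disj L p r r' j : arranged L p -> j \in L r -> j \in L r' -> r = r'.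
Proof.
move=> ar jr jr'; apply/eqP; apply: contraT => ne; have := ar j.
rewrite (bigD1 r) //= (bigD1 r') 1?eq_sym //=.
move: jr jr'; rewrite -!has_pred1 !has_count.
by case: (count_mem _ _) => // c _; case: (count_mem _ _) => // d _; rewrite addSn addnS; case: (0 < p j).
Qed.

Definition set_at T (f : 'I_m -> T) (M : 'I_m) (x : T) r := if r == M then x else f r.

(** The exchange argument.  Machine M becomes available one unit earlier, at time s,
    and job j, which does not start before s + 1, gets one more unit of length.
    If j already runs on M, everything before j on M moves one unit earlier.
    Otherwise let y be the start of j on its machine N, and compare the weight W_N
    of the jobs on N from j on with the weight W_M of the jobs on M.  Either all
    jobs on M move one unit earlier and those on N from j on end one unit later, at
    a change of W_N - W_M; or the tail of N from j on is exchanged with the whole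
    list of M, at a change of (y - s - 1) (W_M - W_N).  One of the two is not
    positive.  The last clause is the invariant under which the next job can be
    treated. *)
Lemma absorb1 s p a L j M :
  arranged L p -> a M = s.+1 -> (forall r, s <= a r) ->
  (forall r, ohead (L r) = Some j -> s < a r /\ r != M) ->
  exists L', [/\ arranged L' (add_unit p j),
    total_wct (add_unit p j) (set_at a M s) L' <= total_wct p a L + (p j == 0) * (w j * s.+1)
    & forall i, i != j -> (forall r, ohead (L r) = Some i -> s < a r /\ r != M) ->
      forall r, ohead (L' r) = Some i -> s < set_at a M s r].
Proof.
move=> ar aM sa hj.
have rest i L' : (forall r, ohead (L' r) = Some i -> s < a r /\ r != M) ->
    forall r, ohead (L' r) = Some i -> s < set_at a M s r.
  by move=> h r /h []; rewrite /set_at; case: eqP.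
(* A finished job j becomes a unit block in front of the list of M. *)
case: (posnP (p j)) => [pj0|pj].
  have nj r : j \notin L r.
    by apply/negP => /(arranged_pos ar); rewrite pj0.
  exists (set_at L M (j :: L M)); split.
  - move=> i; have := ar i; rewrite (bigD1 M) //= => e.
    rewrite (bigD1 M) //= {1}/set_at eqxx /= (eq_bigr (fun r => count_mem i (L r))).
      rewrite -addnA e /add_unit [i == j]eq_sym.
      by case: (j =P i) => [<-|_]; rewrite ?pj0 ?addn0.
    by move=> r rM; rewrite /set_at (negbTE rM).
  - apply: (leq_sum_but1 (M := M)) => [r rM|].
      by rewrite /set_at (negbTE rM) wct_add_unit_notin.
    by rewrite /set_at eqxx wct_add_unit_cons //= pj0 aM addn0 mul1n addnC.
  - move=> i ij h r; rewrite /set_at; case: eqP => [_|_] /=.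
      by move=> [/eqP]; rewrite eq_sym (negbTE ij).
    by move=> /h [].
have [N jN] := arranged_mem ar pj.
have jr r : r != N -> j \notin L r.
  by move=> rN; apply/negP => /(arranged_disj ar jN) e; rewrite e eqxx in rN.
have [l1 [l2 eN]] : exists l1, exists l2, L N = l1 ++ j :: l2.
  by case/splitPr: jN => l1 l2; exists l1, l2.
have := arranged_uniq N ar; rewrite eN cat_uniq /= negb_or.
move=> /and3P [_ /andP [jl1 _]] /andP [jl2 _].
pose y := a N + \sum_(i <- l1) p i.
have cN : wct p (a N) (L N) = wct p (a N) l1 + wct p y (j :: l2) by rewrite eN wct_cat.
have cN1 t : wct (add_unit p j) t (L N) =
    wct p t l1 + wct p (t + \sum_(i <- l1) p i).+1 (j :: l2).
  rewrite eN wct_cat wct_add_unit_notin // wct_add_unit_cons //.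
  congr (_ + wct p (_ + _).+1 _); apply: eq_big_seq => i il1; rewrite /add_unit.
  by case: eqP => [e|]; [rewrite -e il1 in jl1 | rewrite addn0].
have l1_pos : l1 != [::] -> 0 < \sum_(i <- l1) p i.
  case: l1 eN {jl1 cN cN1 y} => // i l1 eN _.
  by rewrite big_cons; have := @arranged_pos L p N i ar; rewrite eN mem_head; lia.
have sy : s < y.
  case: (l1 =P [::]) => [e|/eqP /l1_pos]; last by have := sa N; rewrite /y; lia.
  have [|] := hj N; first by rewrite eN e.
  by rewrite /y; lia.
have arj L' : (forall i, \sum_r count_mem i (L' r) = \sum_r count_mem i (L r)) ->
    arranged L' (add_unit p j).
  move=> h i; rewrite h ar /add_unit; case: eqP => [->|_] /=; last by rewrite addn0.
  by rewrite pj addn1.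
have hd0 i : i != j -> (forall r, ohead (L r) = Some i -> s < a r /\ r != M) ->
      forall r, ohead (L r) = Some i -> s < set_at a M s r by move=> _; apply: rest.
(* j runs on M itself: the jobs before it use the additional unit of the machine. *)
case: (N =P M) => [NM|/eqP NM].
  have l1N : l1 != [::].
    by case: l1 {jl1 cN cN1 y sy l1_pos} eN => // eN; have [] := hj N; rewrite ?eN // NM eqxx.
  exists L; split => //; first exact: arj.
  apply: (leq_sum_but1 (M := M)) => [r rM|].
    by rewrite /set_at (negbTE rM) wct_add_unit_notin ?leqnn // jr // NM.
  rewrite -NM /set_at eqxx cN1 cN /y NM aM addSn.
  have := leq_wct p l1 (leqnSn s); lia.
(* L M is at least as heavy as the tail of L N: the lists stay, M starts one unit earlier. *)
case: (leqP (tail_weight (j :: l2)) (tail_weight (L M))) => [WNM|WMN].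
  exists L; split => //; first exact: arj.
  apply: (leq_sum_but2 (M := M) (N := N)); rewrite 1?eq_sym //.
    by move=> r rM rN; rewrite /set_at (negbTE rM) wct_add_unit_notin ?leqnn // jr.
  rewrite /set_at eqxx (negbTE NM) wct_add_unit_notin ?jr 1?eq_sym //.
  rewrite cN1 cN -/y aM -[in X in _ <= X](addn1 s) -(addn1 y) !wct_delay; lia.
(* The tail of L N is heavier: it is exchanged with L M. *)
pose L' := set_at (set_at L N (l1 ++ L M)) M (j :: l2).
have L'M : L' M = j :: l2 by rewrite /L' /set_at eqxx.
have L'N : L' N = l1 ++ L M by rewrite /L' /set_at (negbTE NM) eqxx.
have L'r r : r != M -> r != N -> L' r = L r.
  by rewrite /L' /set_at => /negbTE -> /negbTE ->.
exists L'; split.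
- apply: arj => i; rewrite (bigD1 M) //= (bigD1 N) //= L'M L'N.
  rewrite [RHS](bigD1 M) //= [in RHS](bigD1 N) //= eN !count_cat /=.
  under eq_bigr => r /andP [rM rN] do rewrite L'r //.
  lia.
- apply: (leq_sum_but2 (M := M) (N := N)); rewrite 1?eq_sym //.
    by move=> r rM rN; rewrite L'r // /set_at (negbTE rM) wct_add_unit_notin ?leqnn // jr.
  have jM : j \notin L M by rewrite jr // eq_sym.
  rewrite L'M L'N /set_at eqxx (negbTE NM) wct_add_unit_cons // wct_add_unit_notin; last first.
    by rewrite mem_cat negb_or jl1.
  rewrite wct_cat cN -/y aM.
  have -> : y = s.+1 + (y - s.+1) by lia.
  rewrite !wct_delay mul0n; have := leq_mul (leqnn (y - s.+1)) (ltnW WMN).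
  move: (wct p s.+1 (j :: l2)) (wct p (a N) l1) (wct p s.+1 (L M)).
  by move: (_ * tail_weight (L M)) (_ * tail_weight (j :: l2)) => *; lia.
- move=> i ij h; apply: rest => r; case: (r =P M) => [->|/eqP rM].
    by rewrite L'M => -[/eqP]; rewrite eq_sym (negbTE ij).
  case: (r =P N) => [->|/eqP rN]; last by rewrite L'r // => /h [].
  rewrite L'N; case: l1 eN {jl1 cN cN1 y sy l1_pos L' L'M L'N L'r} => [|i' l1] eN /=.
    by move=> /h [_]; rewrite eqxx.
  by move=> e; have [|] := h N; rewrite ?eN.
Qed.

Definition add_units p (B : seq J) i := p i + (i \in B).
Definition lower a (R : seq 'I_m) s r := if r \in R then s else a r.

Lemma eq_total_wct p p' a a' L : p =1 p' -> a =1 a' -> total_wct p a L = total_wct p' a' L.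
Proof.
by move=> ep ea; apply: eq_bigr => r _; rewrite ea; apply: eq_wct => i _; apply: ep.
Qed.

Lemma eq_arranged p p' L : p =1 p' -> arranged L p -> arranged L p'.
Proof. by move=> e ar j; rewrite ar e. Qed.

Lemma leq_total_wct p a a' L : (forall r, a r <= a' r) -> total_wct p a L <= total_wct p a' L.
Proof. by move=> le; apply: leq_sum => r _; apply: leq_wct. Qed.

(** The machines of R, idle at time s, process there one unit of each job of B.  The
    jobs are treated one at a time.  A job that is already first on a machine of R
    is matched with that machine before any other choice is made; otherwise a
    machine that begins earlier might run a job of B that is still to be treated,
    and this job would have two units at time s. *)
Lemma absorb s (B : seq J) (R : seq 'I_m) p a L :
  uniq B -> uniq R -> size B <= size R -> arranged L p ->
  (forall r, r \in R -> a r = s.+1) -> (forall r, s <= a r) ->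
  (forall j r, j \in B -> ohead (L r) = Some j -> s < a r) ->
  exists2 L', arranged L' (add_units p B) &
    total_wct (add_units p B) (lower a R s) L' <=
      total_wct p a L + \sum_(j <- B | p j == 0) w j * s.+1.
Proof.
have [k] := ubnP (size B); elim: k B R p a L => // k IH B R p a L; rewrite ltnS => Bk.
move=> uB uR BR ar aR sa hd.
have [B0|Bn] := eqVneq B [::].
  exists L; first by apply: eq_arranged ar => i; rewrite /add_units B0 addn0.
  rewrite B0 big_nil addn0 (@eq_total_wct _ p _ (lower a R s)) //.
    by apply: leq_total_wct => r; rewrite /lower; case: ifP.
  by move=> i; rewrite /add_units addn0.
(* It suffices to put the unit of one job j on one machine M. *)
suff [j [M [jB MR [L1 [ar1 c1 hd1]]]]] : exists j M, [/\ j \in B, M \in R &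
    exists L1, [/\ arranged L1 (add_unit p j),
    total_wct (add_unit p j) (set_at a M s) L1 <= total_wct p a L + (p j == 0) * (w j * s.+1)
    & forall i r, i \in B -> i != j -> ohead (L1 r) = Some i -> s < set_at a M s r]].
  have pB := perm_to_rem jB; have pR := perm_to_rem MR.
  have [L2 ar2 c2] : exists2 L', arranged L' (add_units (add_unit p j) (rem j B)) &
      total_wct (add_units (add_unit p j) (rem j B)) (lower (set_at a M s) (rem M R) s) L' <=
      total_wct (add_unit p j) (set_at a M s) L1 +
        \sum_(i <- rem j B | add_unit p j i == 0) w i * s.+1.
    apply: IH; rewrite ?rem_uniq ?size_rem //.
    - by case: (size B) Bk (perm_size pB).
    - by rewrite -!subn1 leq_sub2r.
    - move=> r; rewrite mem_rem_uniq // inE => /andP [rM /aR].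
      by rewrite /set_at (negbTE rM).
    - by move=> r; rewrite /set_at; case: eqP.
    - by move=> i r; rewrite mem_rem_uniq // inE => /andP [ij iB]; apply: hd1.
  have ep : add_units (add_unit p j) (rem j B) =1 add_units p B.
    move=> i; rewrite /add_units /add_unit mem_rem_uniq // inE.
    by case: eqP => [->|_]; rewrite ?jB ?addn0.
  have ea : lower (set_at a M s) (rem M R) s =1 lower a R s.
    move=> r; rewrite /lower /set_at mem_rem_uniq // inE.
    by case: eqP => [->|_]; rewrite ?MR.
  exists L2; first exact: eq_arranged ar2.
  rewrite -(eq_total_wct _ ep ea); apply: leq_trans c2 _.
  rewrite (perm_big _ pB) /= big_cons.
  have -> : \sum_(i <- rem j B | add_unit p j i == 0) w i * s.+1 =
      \sum_(i <- rem j B | p i == 0) w i * s.+1.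
    rewrite big_seq_cond [RHS]big_seq_cond; apply: eq_bigl => i.
    rewrite mem_rem_uniq // inE /add_unit; case: eqP => //= _.
    by rewrite addn0.
  apply: leq_trans (leq_add c1 (leqnn _)) _; rewrite -addnA leq_add2l.
  by case: (p j == 0); rewrite ?mul1n ?mul0n.
have [/hasP [M MR /hasP [j jB /eqP hM]]|/hasPn nomatch] :=
    boolP (has (fun M => has (fun j => ohead (L M) == Some j) B) R).
  exists j, M; split => //.
  have jM : j \in L M by case: (L M) hM => //= i l [->]; apply: mem_head.
  have jr r : r != M -> j \notin L r.
    by move=> rM; apply/negP => /(arranged_disj ar jM) e; rewrite e eqxx in rM.
  exists L; split.
  - move=> i; rewrite ar /add_unit; case: eqP => [->|_]; last by rewrite addn0.
    by rewrite addn1 (arranged_pos ar jM).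
  - apply: (leq_sum_but1 (M := M)) => [r rM|].
      by rewrite /set_at (negbTE rM) wct_add_unit_notin // jr.
    rewrite /set_at eqxx aR //; have := arranged_uniq M ar.
    case: (L M) hM => //= i l [->] /andP [jl _]; rewrite wct_add_unit_notin //.
    by rewrite /add_unit eqxx addn1 addSn addnS leq_addr.
  - move=> i r iB ij hi; rewrite /set_at; case: eqP => [rM|_]; last exact: hd hi.
    by move: hi; rewrite rM hM => -[/esym/eqP]; rewrite (negbTE ij).
case: B Bn Bk uB BR hd nomatch => // j B _ Bk uB BR hd nomatch.
case: R uR BR aR nomatch => // M R uR BR aR nomatch.
have free i : i \in j :: B -> forall r, ohead (L r) = Some i -> s < a r /\ r != M.
  move=> iB r hi; split; first exact: hd hi.
  apply/eqP => rM; have /negP := nomatch M (mem_head _ _); apply.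
  by apply/hasP; exists i; rewrite // -rM hi.
exists j, M; rewrite !mem_head; split => //.
have [L1 [ar1 c1 hd1]] := absorb1 ar (aR M (mem_head _ _)) sa (free j (mem_head _ _)).
by exists L1; split => // i r iB ij; apply: hd1 => //; apply: free.
Qed.

Lemma absorb_slot s (B : seq J) p L :
  uniq B -> size B <= #|[pred r : 'I_m | r <= s]| -> arranged L p ->
  exists2 L', arranged L' (add_units p B) &
    total_wct (add_units p B) (fun r => maxn s r) L' <=
      total_wct p (fun r => maxn s.+1 r) L + \sum_(j <- B | p j == 0) w j * s.+1.
Proof.
move=> uB BR ar.
have [|||||||L' ar' c] := @absorb s B (enum [pred r : 'I_m | r <= s]) p (fun r => maxn s.+1 r) L.
- by [].
- exact: enum_uniq.
- by rewrite -cardE.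
- exact: ar.
- by move=> r; rewrite mem_enum inE => rs; apply/maxn_idPl; apply: leqW.
- by move=> r; rewrite leq_max leqnSn.
- by move=> j r _ _; rewrite leq_max leqnn.
have el : lower (fun r => maxn s.+1 r) (enum [pred r : 'I_m | r <= s]) s =1 (fun r => maxn s r).
  move=> r; rewrite /lower mem_enum inE; case: leqP => // rs.
  exact/maxn_idPr.
by exists L' => //; rewrite -(eq_total_wct _ (fun=> erefl) el).
Qed.

(** B s is the set of jobs that the preemptive schedule runs in the time unit
    [s, s + 1).  The induction goes from the horizon T back to time 0: the
    nonpreemptive schedule of the work done from s + 1 on absorbs the units of
    time s. *)
Theorem nonpreemptive_wins (B : nat -> seq J) (C : J -> nat) (T : nat) :
  (forall s, uniq (B s)) -> (forall s, size (B s) <= #|[pred r : 'I_m | r <= s]|) ->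
  (forall s j, j \in B s -> s < C j) ->
  let p j := \sum_(0 <= s < T) (j \in B s) in
  exists2 L, arranged L p &
    total_wct p (fun r => r) L <= \sum_(j | 0 < p j) w j * C j.
Proof.
move=> uB szB BC.
pose q s j := \sum_(s <= t < T) (j \in B t).
suff main k s : k + s = T -> exists2 L, arranged L (q s) &
    total_wct (q s) (fun r => maxn s r) L <= \sum_(j | 0 < q s j) w j * C j.
  have [L ar c] := main T 0 (addn0 T); exists L => //.
  by apply: leq_trans c; apply: leq_total_wct => r; rewrite max0n.
elim: k s => [|k IH] s ekT.
  have q0 j : q s j = 0 by rewrite /q big_geq // -ekT.
  exists (fun=> [::]) => [j|]; first by rewrite q0 big1.
  by rewrite /total_wct big1.
have [|L ar c] := IH s.+1; first by rewrite addnS.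
have [L' ar' c'] := absorb_slot (uB s) (szB s) ar.
have eq : add_units (q s.+1) (B s) =1 q s.
  by move=> j; rewrite /add_units addnC /q [RHS]big_ltn // -ekT addSn ltnS leq_addl.
exists L'; first exact: eq_arranged ar'.
rewrite -(eq_total_wct _ eq (fun=> erefl)).
apply: leq_trans c' _; rewrite [X in _ <= X](bigID (fun j => 0 < q s.+1 j)) /=.
apply: leq_add.
  apply: leq_trans c _; rewrite [X in _ <= X](eq_bigl (fun j => 0 < q s.+1 j)) // => j.
  by rewrite -eq /add_units; case: (q s.+1 j) => //= ; rewrite andbF.
rewrite big_mkcond big_uniq //= -big_mkcondr.
rewrite [X in _ <= X](eq_bigl (fun j => (j \in B s) && (q s.+1 j == 0))) => [|j]; last first.
  by rewrite -eq /add_units; case: (q s.+1 j) (j \in B s) => [|c0] [].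
by apply: leq_sum => j /andP [jB _]; rewrite leq_mul2l BC ?orbT.
Qed.

End LowerBound.

(** * Smith's order *)

Section Smith.
Variables (J : finType) (w p : J -> nat).
Hypothesis p_gt0 : forall j, 0 < p j.

(** w i / p i >= w j / p j, without division. *)
Definition smith i j := w j * p i <= w i * p j.

Fixpoint ins j (l : seq J) :=
  if l is i :: l' then if smith j i then j :: l else i :: ins j l' else [:: j].

Definition isort (l : seq J) := foldr ins [::] l.

Lemma smith_trans : transitive smith.
Proof.
move=> j i k; rewrite /smith => ij jk.
have := p_gt0 j; move: ij jk (p_gt0 i) (p_gt0 k) => ij jk _ _ pj.
rewrite -(leq_pmul2r pj).
have := leq_mul jk (leqnn (p i)); have := leq_mul ij (leqnn (p k)).
move: (w i) (w j) (w k) (p i) (p j) (p k) => a b c x y z; lia.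
Qed.

Lemma smith_total : total smith.
Proof. by move=> i j; apply: leq_total. Qed.

Lemma perm_ins j l : perm_eq (ins j l) (j :: l).
Proof.
elim: l => //= i l IH; case: ifP => // _.
rewrite perm_sym (perm_catCA [:: j] [:: i] l) perm_cons perm_sym.
exact: IH.
Qed.

Lemma perm_isort l : perm_eq (isort l) l.
Proof.
by elim: l => //= j l IH; rewrite (permPl (perm_ins j _)) perm_cons.
Qed.

Lemma pairwise_isort l : pairwise smith (isort l).
Proof.
elim: l => //= j l; elim: (isort l) => //= i s IH /andP [ai ps].
case: ifP => [ji|nji] /=; first by rewrite ji ai ps (sub_all _ ai) // => k; apply: smith_trans.
rewrite IH // andbT (perm_all _ (perm_ins j s)) /= ai andbT.
by have := smith_total i j; rewrite nji orbF.
Qed.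

(** Adjacent jobs in the wrong order of ratio w / p may be exchanged, so j can move
    to the front. *)
Lemma wct_front t j l1 l2 : all (smith j) l1 ->
  wct w p t (j :: l1 ++ l2) <= wct w p t (l1 ++ j :: l2).
Proof.
elim: l1 t => // i l1 IH t /andP [ji al].
apply: leq_trans (_ : wct w p t (i :: j :: l1 ++ l2) <= _).
  rewrite /= (addnAC t (p i)) !addnA leq_add2r; move: ji; rewrite /smith; nia.
by rewrite /= leq_add2l; apply: IH.
Qed.

Lemma wct_smith t s l : pairwise smith s -> perm_eq s l -> wct w p t s <= wct w p t l.
Proof.
elim: s t l => [|j s IH] t l /=; first by rewrite perm_sym => _ /perm_nilP ->.
move=> /andP [aj ps] sl.
have jl : j \in l by rewrite -(perm_mem sl) mem_head.
case/splitPr: jl sl => l1 l2; rewrite perm_sym perm_catC /= perm_cons perm_sym => sl.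
have sl' : perm_eq s (l1 ++ l2) by rewrite (permPl sl) perm_catC.
apply: leq_trans (wct_front _ _ _); last first.
  by move: aj; rewrite (perm_all _ sl') all_cat => /andP [].
by rewrite /= leq_add2l; apply: IH.
Qed.

(** Only the assignment of jobs to machines matters: each list can be replaced by the
    jobs of its machine in Smith's order. *)
Lemma smith_assignment m (t : 'I_m -> nat) (L : 'I_m -> seq J) s :
  pairwise smith s -> perm_eq s (enum J) -> arranged L p ->
  exists f : {ffun J -> 'I_m},
    \sum_r wct w p (t r) [seq j <- s | f j == r] <= total_wct w p t L.
Proof.
move=> ps es ar.
have ex j : exists r, j \in L r by apply: arranged_mem ar (p_gt0 j).
exists [ffun j => xchoose (ex j)]; apply: leq_sum => r _.
apply: wct_smith; first exact: pairwise_filter.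
apply: uniq_perm; rewrite ?(arranged_uniq r ar) ?filter_uniq ?(perm_uniq es) ?enum_uniq //.
move=> j; rewrite mem_filter (perm_mem es) mem_enum andbT ffunE.
apply/eqP/idP => [<-|jr]; first exact: (xchooseP (ex j)).
exact: arranged_disj ar (xchooseP (ex j)) jr.
Qed.

End Smith.

(** * Dynamic programming with discarded states *)

Section TrimmedDP.
Variables (J : finType) (w p key : J -> nat) (m : nat).
Hypothesis key_inj : injective key.

(* The vector holds the cost followed by the times at which the machines become free;
   the association list gives the start times chosen so far, under the job keys. *)
Local Notation dpstate := (seq nat * seq (nat * nat))%type.
Implicit Types (x y : dpstate) (X acc : seq dpstate) (v ts : seq nat) (sol : seq (nat * nat)).

Definition extend j r x : dpstate :=
  let a := nth 0 (behead x.1) r in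
  (head 0 x.1 + w j * (a + p j) :: set_nth 0 (behead x.1) r (a + p j),
   (key j, a) :: x.2).

Definition init_state : dpstate := (0 :: iota 0 m, [::]).

Fixpoint lookup i sol :=
  if sol is (k, t) :: sol' then if k == i then t else lookup i sol' else 0.

Definition schedule_cost sol s := \sum_(j <- s) w j * (lookup (key j) sol + p j).

(** What makes the association list of x a schedule of the jobs of s.  As all lengths
    are multiples of m, the machine of a job is its start time modulo m, so it need
    not be stored. *)
Definition consistent s x := exists ts, [/\ x.1 = schedule_cost x.2 s :: ts,
  size ts = m,
  forall r, r < m -> nth 0 ts r = r %[mod m] /\ nth 0 ts r <= r + \sum_(j <- s) p j
  & [/\ map fst x.2 = rev (map key s),
     forall j, j \in s -> lookup (key j) x.2 + p j <= nth 0 ts (lookup (key j) x.2 %% m)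
   & forall i j, i \in s -> j \in s -> i != j ->
     lookup (key i) x.2 = lookup (key j) x.2 %[mod m] ->
     lookup (key i) x.2 + p i <= lookup (key j) x.2 \/
     lookup (key j) x.2 + p j <= lookup (key i) x.2]].

Hypothesis m_gt0 : 0 < m.
Hypothesis p_mod : forall j, p j = 0 %[mod m].

Lemma consistent_init : consistent [::] init_state.
Proof.
exists (iota 0 m); split => //; first by rewrite /schedule_cost big_nil.
  exact: size_iota.
by move=> r rm; rewrite nth_iota // big_nil addn0.
Qed.

Lemma consistent_extend s j r x :
  j \notin s -> r < m -> consistent s x -> consistent (rcons s j) (extend j r x).
Proof.
case: x => v sol js rm [ts [/= -> szts tsm [ks tsend disj]]].
have lk i : i \in s -> lookup (key i) ((key j, nth 0 ts r) :: sol) = lookup (key i) sol.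
  by move=> si /=; rewrite (inj_eq key_inj); case: eqP => // e; rewrite e si in js.
have lj : lookup (key j) ((key j, nth 0 ts r) :: sol) = nth 0 ts r by rewrite /= eqxx.
exists (set_nth 0 ts r (nth 0 ts r + p j)); split.
- congr (_ :: _); rewrite /schedule_cost -cats1 big_cat big_seq1 /= eqxx.
  by congr (_ + _); apply: eq_big_seq => i si; have /= -> := lk i si.
- by rewrite size_set_nth szts; apply/maxn_idPr.
- move=> r' r'm; rewrite nth_set_nth /= -cats1 big_cat big_seq1 /=.
  have [er er'] := tsm r' r'm; split.
    case: eqP => // <-; rewrite -modnDmr p_mod mod0n addn0; exact: er.
  by case: eqP => [<-|_]; rewrite ?addnA ?leq_add2r //; lia.
have rr : nth 0 ts r %% m = r by have [-> _] := tsm r rm; rewrite modn_small.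
split.
- by rewrite map_rcons rev_rcons /= ks.
- move=> i; rewrite mem_rcons inE => /orP [/eqP ->|si].
    by rewrite lj rr nth_set_nth /= eqxx.
  rewrite lk // nth_set_nth /=; have := tsend i si; case: eqP => // -> h.
  exact: leq_trans h (leq_addr _ _).
have new i : i \in s -> lookup (key i) sol = nth 0 ts r %[mod m] ->
   lookup (key i) sol + p i <= nth 0 ts r.
  by move=> si e; have := tsend i si; rewrite e rr.
move=> i k; rewrite !mem_rcons !inE => /orP [/eqP ->|si] /orP [/eqP ->|sk] ik.
- by rewrite eqxx in ik.
- by rewrite lj lk // => e; right; apply: new.
- by rewrite lj lk // => e; left; apply: new.
- by rewrite !lk //; apply: disj.
Qed.

Definition follow (f : J -> nat) s x := foldl (fun x j => extend j (f j) x) x s.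

Lemma foldl_consistent (f : J -> nat) s1 s2 x :
  uniq (s1 ++ s2) -> (forall j, f j < m) -> consistent s1 x -> consistent (s1 ++ s2) (follow f s2 x).
Proof.
move=> + fm; elim: s2 s1 x => [|j s2 IH] s1 x /=; first by rewrite cats0.
rewrite -cat_rcons => u c; apply: IH => //; apply: consistent_extend => //.
by move: u; rewrite cat_uniq rcons_uniq => /andP [/andP []].
Qed.

Lemma consistent_follow f s : uniq s -> (forall j, f j < m) -> consistent s (follow f s init_state).
Proof. by move=> u fm; apply: (@foldl_consistent f [::] s) => //; exact: consistent_init. Qed.

(** A fixed assignment f leads to the cost of running the jobs of each machine in the
    order of s. *)
Lemma follow_cost (f : J -> 'I_m) s x : size x.1 = m.+1 ->
  head 0 (follow f s x).1 =
    head 0 x.1 + \sum_(r < m) wct w p (nth 0 (behead x.1) r) [seq j <- s | f j == r].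
Proof.
elim: s x => [|j s IH] [v sol] /=; first by rewrite big1 ?addn0.
case: v => // z ts [sz]; rewrite IH /=; last first.
  by rewrite size_set_nth sz; congr _.+1; apply/maxn_idPr.
rewrite -addnA; congr (_ + _); rewrite (bigD1 (f j)) //= nth_set_nth /= eqxx.
rewrite [RHS](bigD1 (f j)) //= eqxx /= addnA; congr (_ + _).
apply: eq_bigr => r rf; rewrite nth_set_nth /= [f j == r]eq_sym (negbTE rf).
by case: eqP => // /val_inj e; rewrite e eqxx in rf.
Qed.

Variable N : nat.

(** u <= (1 + 1/N) v in each coordinate. *)
Definition dominates u v := all2 (fun a b => N * a <= N.+1 * b) u v.
Definition covered v acc := has (fun x => dominates x.1 v) acc.
Definition add_state x acc := if covered x.1 acc then acc else x :: acc.

Fixpoint each j x r acc :=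
  if r is r'.+1 then each j x r' (add_state (extend j r' x) acc) else acc.

Fixpoint stage j X acc :=
  if X is x :: X' then stage j X' (each j x m acc) else acc.

Fixpoint dp s X := if s is j :: s' then dp s' (stage j X [::]) else X.

Fixpoint best X x :=
  if X is x' :: X' then let b := best X' x' in if head 0 x.1 <= head 0 b.1 then x else b
  else x.

Lemma dominates_refl v : dominates v v.
Proof. by rewrite /dominates; elim: v => //= a v ->; rewrite leq_mul2r leqnSn orbT. Qed.

Lemma sub_add_state x acc : {subset acc <= add_state x acc}.
Proof. by move=> y ya; rewrite /add_state; case: ifP => // _; rewrite inE ya orbT. Qed.

Lemma add_state_covers x acc : exists2 u, u \in add_state x acc & dominates u.1 x.1.
Proof.
rewrite /add_state /covered; case: ifP => [/hasP //|_].
by exists x; [apply: mem_head | apply: dominates_refl].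
Qed.

Lemma sub_each j x r acc : {subset acc <= each j x r acc}.
Proof. by elim: r acc => [|r IH] acc y yi //=; apply/IH/sub_add_state. Qed.

Lemma each_covers j x r r' acc : r' < r ->
  exists2 u, u \in each j x r acc & dominates u.1 (extend j r' x).1.
Proof.
elim: r acc => // r IH acc; rewrite ltnS leq_eqVlt => /orP [/eqP ->|r'r]; last exact: IH.
have [u ui du] := add_state_covers (extend j r x) acc.
exists u; last exact: du.
exact: sub_each ui.
Qed.

Lemma sub_stage j X acc : {subset acc <= stage j X acc}.
Proof. by elim: X acc => [|x X IH] acc y yi //=; apply/IH/sub_each. Qed.

Lemma stage_covers j X acc x r : x \in X -> r < m ->
  exists2 u, u \in stage j X acc & dominates u.1 (extend j r x).1.
Proof.
move=> xX rm; elim: X xX acc => // y X IH; rewrite inE => /orP [/eqP <-|xX] acc; last exact: IH.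
have [u ui du] := each_covers j x acc rm.
by exists u; [exact: sub_stage ui | exact: du].
Qed.

Lemma add_state_ind (Q : dpstate -> Prop) x acc :
  Q x -> (forall y, y \in acc -> Q y) -> forall y, y \in add_state x acc -> Q y.
Proof.
move=> Qx Qa y; rewrite /add_state; case: ifP => _; first exact: Qa.
by rewrite inE => /orP [/eqP ->|/Qa].
Qed.

Lemma each_ind (Q : dpstate -> Prop) j x r acc :
  (forall r', r' < r -> Q (extend j r' x)) -> (forall y, y \in acc -> Q y) ->
  forall y, y \in each j x r acc -> Q y.
Proof.
elim: r acc => //= r IH acc Qx Qa; apply: IH => [r' r'r|].
  by apply: Qx; apply: leqW.
by apply: add_state_ind => //; apply: Qx.
Qed.

Lemma stage_ind (Q : dpstate -> Prop) j X acc :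
  (forall x r, x \in X -> r < m -> Q (extend j r x)) -> (forall y, y \in acc -> Q y) ->
  forall y, y \in stage j X acc -> Q y.
Proof.
elim: X acc => //= x X IH acc Qx Qa; apply: IH => [y r yX|].
  by apply: Qx; rewrite inE yX orbT.
by apply: each_ind => // r; apply: Qx; apply: mem_head.
Qed.

(** u <= (1 + 1/N)^k v in each coordinate; beyond the ends both sides are 0. *)
Definition approx k (u v : seq nat) :=
  size u = size v /\ forall i, N ^ k * nth 0 u i <= N.+1 ^ k * nth 0 v i.

(** Extending a state is monotone and adds the same job data to both sides, so it does
    not increase the relative error. *)
Lemma approx_extend k j r x y : r < m -> size x.1 = m.+1 ->
  approx k x.1 y.1 -> approx k (extend j r x).1 (extend j r y).1.
Proof.
case: x y => [[|z ts] sx] [v' sy] rm //= [sz] [].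
case: v' => [|z' ts'] // [e] h; rewrite /=.
have hz := h 0; have ht i := h i.+1; rewrite /= in hz ht.
have le : N ^ k <= N.+1 ^ k by case: (k) => // k'; rewrite leq_exp2r.
have hr : N ^ k * (nth 0 ts r + p j) <= N.+1 ^ k * (nth 0 ts' r + p j).
  by rewrite !mulnDr leq_add // leq_mul2r le orbT.
split=> [|[|i]] /=; first by rewrite !size_set_nth e.
  by rewrite !mulnDr leq_add // -!mulnDr !mulnA ![_ * w j]mulnC -!mulnA leq_mul2l hr orbT.
by rewrite !nth_set_nth /=; case: eqP => // _; apply: ht.
Qed.

(** Replacing a state by one that dominates it costs one more factor 1 + 1/N. *)
Lemma approx_dominates k u v v' : size u = size v ->
  dominates u v -> approx k v v' -> approx k.+1 u v'.
Proof.
move=> su d [sv h]; split; first by rewrite su.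
move=> i; rewrite !expnS -!mulnA.
have di : N * nth 0 u i <= N.+1 * nth 0 v i.
  case: (ltnP i (size u)) => iu; last by rewrite !nth_default ?muln0 // -su.
  move: d; rewrite /dominates all2E => /andP [_ /all_nthP].
  by move=> /(_ (0, 0) i); rewrite size_zip su minnn -su nth_zip //; apply.
rewrite mulnCA; apply: leq_trans (_ : N ^ k * (N.+1 * nth 0 v i) <= _).
  by rewrite leq_mul2l di orbT.
by rewrite mulnCA leq_mul2l h orbT.
Qed.
 
Lemma size_extend j r x : r < m -> size x.1 = m.+1 -> size (extend j r x).1 = m.+1.
Proof.
case: x => [[|z ts] sx] //= rm [e]; rewrite size_set_nth e; congr _.+1.
exact/maxn_idPr.
Qed.

Lemma dominates_size u v : dominates u v -> size u = size v.
Proof. by rewrite /dominates all2E => /andP [/eqP]. Qed.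

(** The states reached along f may be discarded, but after each job some survivor is
    a good substitute. *)
Lemma dp_approx (f : J -> nat) s X k y : (forall j, f j < m) ->
  (forall x, x \in X -> size x.1 = m.+1) ->
  (exists2 x, x \in X & approx k x.1 y.1) ->
  exists2 x, x \in dp s X & approx (k + size s) x.1 (follow f s y).1.
Proof.
move=> fm; elim: s X k y => [|j s IH] X k y szX [x xX ax] /=; first by exists x; rewrite ?addn0.
rewrite -addSnnS; apply: IH => [|].
  by apply: stage_ind => // x' r /szX szx' rm; apply: size_extend.
have [u uX du] := stage_covers j [::] xX (fm j).
exists u => //; apply: approx_dominates (dominates_size du) du _.
by apply: approx_extend => //; apply: szX.
Qed.

Lemma dp_consistent s1 s2 X : uniq (s1 ++ s2) ->
  (forall x, x \in X -> consistent s1 x) ->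
  forall x, x \in dp s2 X -> consistent (s1 ++ s2) x.
Proof.
elim: s2 s1 X => [|j s2 IH] s1 X; first by rewrite cats0.
rewrite -cat_rcons => u c; apply: IH => //; apply: stage_ind => // x r xX rm.
apply: consistent_extend => //; last exact: c.
by move: u; rewrite cat_uniq rcons_uniq => /andP [/andP []].
Qed.

Lemma best_mem X x : best X x \in x :: X.
Proof.
elim: X x => [|x' X IH] x /=; first exact: mem_head.
by case: ifP => _; rewrite in_cons ?eqxx // IH orbT.
Qed.

Lemma best_min X x y : y \in x :: X -> head 0 (best X x).1 <= head 0 y.1.
Proof.
elim: X x => [|x' X IH] x /=; first by rewrite inE => /eqP ->.
rewrite inE => /orP [/eqP ->|/IH le].
  by case: ifP => // /negbT; rewrite -ltnNge => /ltnW.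
by case: ifP => // h; apply: leq_trans h le.
Qed.

Theorem dp_near_optimal (f : J -> 'I_m) s X x : dp s [:: init_state] = x :: X ->
  N ^ size s * head 0 (best X x).1 <=
  N.+1 ^ size s * \sum_(r < m) wct w p r [seq j <- s | f j == r].
Proof.
move=> e; have [|||u uX [_ /(_ 0)]] := @dp_approx f s [:: init_state] 0 init_state.
- by [].
- by move=> y; rewrite inE => /eqP -> /=; rewrite size_iota.
- by exists init_state; rewrite ?mem_head //; split => // i; rewrite !mul1n.
rewrite !nth0 follow_cost /= ?size_iota // add0n e in uX *.
move=> h; apply: leq_trans (leq_trans h _); first by rewrite leq_mul2l best_min ?orbT.
rewrite leq_mul2l; apply/orP; right; apply: leq_sum => r _.
by rewrite nth_iota.
Qed.

Lemma dp_neq0 s X : X != [::] -> dp s X != [::].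
Proof.
elim: s X => //= j s IH [|x X] // _; apply: IH.
have [|u + _] := @stage_covers j (x :: X) [::] x 0 _ m_gt0; first exact: mem_head.
by case: (stage _ _ _).
Qed.

End TrimmedDP.

(** * Number of retained states *)

(** (1 + 1/N)^k >= 1 + k/N, cleared of denominators. *)
Lemma bernoulli_lower N k : (N + k) * N ^ k <= N * N.+1 ^ k.
Proof.
elim: k => [|k IH]; first by rewrite addn0.
rewrite !expnS; move: IH; move: (N ^ k) (N.+1 ^ k) => a b; nia.
Qed.

(** (1 + 1/N)^k (1 - k/N) <= 1: each factor loses, as (1 + 1/N) (N - k - 1) <= N - k. *)
Lemma bernoulli_upper N k : N.+1 ^ k * (N - k) <= N ^ k.+1.
Proof.
elim: k => [|k IH]; first by rewrite subn0 mul1n expn1.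
have le : N.+1 * (N - k.+1) <= N * (N - k) by nia.
rewrite expnS -mulnA (mulnCA N.+1) [N ^ _]expnS.
apply: leq_trans (_ : N.+1 ^ k * (N * (N - k)) <= _); first by rewrite leq_mul2l le orbT.
by rewrite mulnCA leq_mul2l IH orbT.
Qed.

(** (1 + 1/N)^n <= 1 + 1/K once N >= n (K + 1). *)
Lemma ratio_pow_le N n K : 0 < N -> n * K.+1 <= N -> N.+1 ^ n * K <= K.+1 * N ^ n.
Proof.
move=> N0 le; rewrite -(leq_pmul2l N0).
apply: leq_trans (_ : N.+1 ^ n * (K.+1 * (N - n)) <= _).
  rewrite mulnCA leq_mul2l; apply/orP; right; nia.
by rewrite !(mulnCA _ K.+1) leq_mul2l -expnS bernoulli_upper orbT.
Qed.

Lemma double_pow N : 0 < N -> 2 * N ^ N <= N.+1 ^ N.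
Proof.
move=> N0; rewrite -(leq_pmul2l N0).
by apply: leq_trans (bernoulli_lower N N); rewrite mulnA addnn -mul2n (mulnC N).
Qed.

Section Levels.
Variables (N b : nat).
Hypothesis N0 : 0 < N.

(** The cell of x in the geometric grid of ratio 1 + 1/N; the value 0 has the cell 0 to
    itself.  As (1 + 1/N)^N >= 2, numbers of b bits have level at most N b. *)
Definition level x := find (fun e => x * N ^ e < N.+1 ^ e) (iota 0 (N * b).+1).

Lemma level_bound x : x < 2 ^ b -> level x < (N * b).+1 /\ x * N ^ level x < N.+1 ^ level x.
Proof.
move=> xb; have h : has (fun e => x * N ^ e < N.+1 ^ e) (iota 0 (N * b).+1).
  apply/hasP; exists (N * b); first by rewrite mem_iota /= ltnSn.
  rewrite !expnM; apply: leq_trans (_ : 2 ^ b * (N ^ N) ^ b <= _).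
    by rewrite ltn_pmul2r // !expn_gt0 N0.
  rewrite -expnMn; case: (b) => // b'; rewrite leq_exp2r //; exact: double_pow.
have := h; rewrite has_find size_iota => lt; split => //.
by have := nth_find 0 h; rewrite nth_iota.
Qed.

Lemma same_level x y : x < 2 ^ b -> y < 2 ^ b -> level x = level y -> N * x <= N.+1 * y.
Proof.
move=> /level_bound [_ hx] /level_bound [ly _] e.
move: hx; rewrite e; case el : (level y) => [|k]; first by rewrite !muln1 ltnS leqn0 => /eqP ->; rewrite muln0.
have : (y * N ^ k < N.+1 ^ k) = false.
  have kl : k < level y by rewrite el.
  have := before_find 0 kl; rewrite nth_iota ?add0n //; exact: leq_trans kl (ltnW ly).
move=> /negbT; rewrite -leqNgt !expnS.
move=> hy hx; apply: ltnW.
rewrite -(@ltn_pmul2r (N ^ k)) ?expn_gt0 ?N0 // -mulnA mulnCA.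
by apply: leq_trans hx _; rewrite -mulnA leq_mul2l hy orbT.
Qed.

(** Vectors with the same levels dominate each other, so the vectors of V have distinct
    tuples of levels. *)
Lemma antichain_size q (V : seq (seq nat)) :
  all (fun v => (size v == q) && all (fun a => a < 2 ^ b) v) V ->
  pairwise (fun u v => ~~ dominates N v u) V -> size V <= (N * b).+1 ^ q.
Proof.
pose g v := [ffun i : 'I_q => inord (level (nth 0 v i)) : 'I_(N * b).+1].
move=> aV pV; have -> : (N * b).+1 ^ q = #|{ffun 'I_q -> 'I_(N * b).+1}| by rewrite card_ffun !card_ord.
rewrite -(size_map g).
rewrite -(card_uniqP _) ?max_card // uniq_pairwise pairwise_map.
apply: (sub_in_pairwise _ aV pV) => u v /andP [/eqP su au] /andP [/eqP sv av].
apply: contraNneq => e; rewrite /dominates all2E su sv eqxx /=.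
apply/(all_nthP (0, 0)) => i; rewrite size_zip su sv minnn => iq.
rewrite nth_zip ?su ?sv //=.
have hu : nth 0 u i < 2 ^ b by apply: (allP au); rewrite mem_nth ?su.
have hv : nth 0 v i < 2 ^ b by apply: (allP av); rewrite mem_nth ?sv.
apply: same_level => //; have := congr1 (fun f : {ffun 'I_q -> 'I_(N * b).+1} => nat_of_ord (f (Ordinal iq))) e.
by rewrite !ffunE /= !inordK //; case: (level_bound hu); case: (level_bound hv).
Qed.

End Levels.

(** * Evaluation with a bound on the cost *)

(** Costs are only bounded: exact costs would depend on all numbers involved. *)
Definition ev P env e v C := exists2 c, eval P env e v c & c <= C.
Local Notation calls P f v r C := (ev P [:: v] (nth (Lit 0) P f) r C).

Section Ev.
Variable P : program.
Implicit Types (env : seq val) (e : expr) (v r : val).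

Lemma ev_conv env e v C v' C' : ev P env e v C -> v = v' -> C <= C' -> ev P env e v' C'.
Proof. by move=> [c ec le] <- le'; exists c => //; apply: leq_trans le'. Qed.

Lemma ev_var env i v : i < size env -> nth (Num 0) env i = v -> ev P env (Var i) v 1.
Proof. by move=> lt <-; exists 1 => //; apply: EVar. Qed.

Lemma ev_lit env n : ev P env (Lit n) (Num n) (bitlen n).
Proof. by exists (bitlen n) => //; apply: ELit. Qed.

Lemma ev_op env o e1 e2 a b C1 C2 : ev P env e1 (Num a) C1 -> ev P env e2 (Num b) C2 ->
  ev P env (Op o e1 e2) (Num (binop_sem o a b)) (C1 + C2 + (bitlen a + bitlen b)).
Proof.
move=> [c1 h1 l1] [c2 h2 l2]; exists (c1 + c2 + (bitlen a + bitlen b)); first exact: EOp.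
by rewrite leq_add2r leq_add.
Qed.

Lemma ev_pair env e1 e2 v1 v2 C1 C2 : ev P env e1 v1 C1 -> ev P env e2 v2 C2 ->
  ev P env (MkPair e1 e2) (Pair v1 v2) (C1 + C2).+1.
Proof.
by move=> [c1 h1 l1] [c2 h2 l2]; exists (c1 + c2).+1; [exact: EMkPair | rewrite ltnS leq_add].
Qed.

Lemma ev_fst env e v1 v2 C : ev P env e (Pair v1 v2) C -> ev P env (Fst e) v1 C.+1.
Proof. by move=> [c h l]; exists c.+1 => //; apply: EFst h. Qed.

Lemma ev_snd env e v1 v2 C : ev P env e (Pair v1 v2) C -> ev P env (Snd e) v2 C.+1.
Proof. by move=> [c h l]; exists c.+1 => //; apply: ESnd h. Qed.

Lemma ev_if env e e1 e2 b v C1 C2 : ev P env e b C1 ->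
  ev P env (if is_zero b then e2 else e1) v C2 -> ev P env (If e e1 e2) v (C1 + C2).+1.
Proof.
by move=> [c1 h1 l1] [c2 h2 l2]; exists (c1 + c2).+1; [exact: EIf h2 | rewrite ltnS leq_add].
Qed.

Lemma ev_let env e1 e2 v1 v2 C1 C2 : ev P env e1 v1 C1 -> ev P (v1 :: env) e2 v2 C2 ->
  ev P env (Let e1 e2) v2 (C1 + C2).+1.
Proof.
by move=> [c1 h1 l1] [c2 h2 l2]; exists (c1 + c2).+1; [exact: ELet h2 | rewrite ltnS leq_add].
Qed.

Lemma ev_call env f e v1 v2 C1 C2 : f < size P -> ev P env e v1 C1 -> calls P f v1 v2 C2 ->
  ev P env (Call f e) v2 (C1 + C2).+1.
Proof.
by move=> lt [c1 h1 l1] [c2 h2 l2]; exists (c1 + c2).+1; [exact: ECall h2 | rewrite ltnS leq_add].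
Qed.

End Ev.

(* Evaluates everything except conditionals and calls. *)
Ltac evs := repeat first
 [ eapply ev_var; [reflexivity | reflexivity]
 | eapply ev_lit | eapply ev_pair | eapply ev_fst | eapply ev_snd | eapply ev_op
 | eapply ev_let ].

Lemma bitlen0 : bitlen 0 = 1. Proof. by []. Qed.
Lemma bitlen1 : bitlen 1 = 1. Proof. by []. Qed.

Lemma leq_bitlen a b : a <= b -> bitlen a <= bitlen b.
Proof. by move=> ab; rewrite ltnS leq_trunc_log. Qed.

Lemma bitlen_le a B : a < 2 ^ B -> 0 < B -> bitlen a <= B.
Proof.
case: (posnP a) => [-> //|a0] aB _; rewrite /bitlen.
by rewrite -(ltn_exp2l (m := 2)) //; apply: leq_ltn_trans aB; apply: trunc_logP.
Qed.

Lemma ltn_2bitlen a : a < 2 ^ bitlen a.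
Proof. exact: trunc_log_ltn. Qed.

(** * The program *)

(* Positions of the functions in the program. *)
Local Notation MAIN := 0 (only parsing).
Local Notation LEN := 1 (only parsing).
Local Notation PROD := 2 (only parsing).
Local Notation PREP := 3 (only parsing).
Local Notation INS := 4 (only parsing).
Local Notation DP := 5 (only parsing).
Local Notation STAGE := 6 (only parsing).
Local Notation EACH := 7 (only parsing).
Local Notation INSERT := 8 (only parsing).
Local Notation COVERED := 9 (only parsing).
Local Notation DOM := 10 (only parsing).
Local Notation EXT := 11 (only parsing).
Local Notation NTH := 12 (only parsing).
Local Notation UPD := 13 (only parsing).
Local Notation BEST := 14 (only parsing).
Local Notation OUT := 15 (only parsing).
Local Notation LOOKUP := 16 (only parsing).

Section ProgramText.
Variables (m K : nat).

Definition tuple_expr := foldr MkPair (Lit 0).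
Local Notation "x .1" := (Fst x). Local Notation "x .2" := (Snd x).
Local Notation v0 := (Var 0). 

(* The argument of a function is a nested pair, bound to Var 0.  The empty list is the
   atom 0 and a nonempty one is a pair, so that If tells them apart. *)
Definition len_body := If v0 (Op Add (Lit 1) (Call LEN v0.2)) (Lit 0).
Definition prod_body := If v0 (Op Mul v0.1.2.2 (Call PROD v0.2)) (Lit 1).
Definition prep_body :=
  let l := v0.1 in let i := v0.2.1 in let D := v0.2.2 in
  If l (Call INS (MkPair
          (MkPair i (MkPair (Op Mul (Lit m) l.1.1) (Op Mul l.1.2.1 (Op Div D l.1.2.2))))
          (Call PREP (MkPair l.2 (MkPair (Op Add i (Lit 1)) D)))))
       (Lit 0).
Definition ins_body :=
  let x := v0.1 in let l := v0.2 in
  If l (If (Op Leq (Op Mul l.1.2.2 x.2.1) (Op Mul x.2.2 l.1.2.1))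
          (MkPair x l) (MkPair l.1 (Call INS (MkPair x l.2))))
       (MkPair x (Lit 0)).
Definition dp_body :=
  let N := v0.1 in let s := v0.2.1 in let X := v0.2.2 in
  If s (Call DP (MkPair N (MkPair s.2
          (Call STAGE (MkPair N (MkPair s.1 (MkPair X (Lit 0))))))))
       X.
Definition stage_body :=
  let N := v0.1 in let j := v0.2.1 in let X := v0.2.2.1 in let acc := v0.2.2.2 in
  If X (Call STAGE (MkPair N (MkPair j (MkPair X.2
          (Call EACH (MkPair N (MkPair j (MkPair X.1 (MkPair (Lit m) acc)))))))))
       acc.
Definition each_body :=
  let N := v0.1 in let j := v0.2.1 in let x := v0.2.2.1 in let r := v0.2.2.2.1 in
  let acc := v0.2.2.2.2 in
  If r (Call EACH (MkPair N (MkPair j (MkPair x (MkPair (Op Sub r (Lit 1))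
          (Call INSERT (MkPair N (MkPair
             (Call EXT (MkPair j (MkPair (Op Sub r (Lit 1)) x))) acc))))))))
       acc.
Definition insert_body :=
  let N := v0.1 in let x := v0.2.1 in let acc := v0.2.2 in
  If (Call COVERED (MkPair N (MkPair x.1 acc))) acc (MkPair x acc).
Definition covered_body :=
  let N := v0.1 in let v := v0.2.1 in let acc := v0.2.2 in
  If acc (If (Call DOM (MkPair N (MkPair acc.1.1 v))) (Lit 1)
            (Call COVERED (MkPair N (MkPair v acc.2))))
         (Lit 0).
Definition dom_body :=
  let N := v0.1 in let u := v0.2.1 in let v := v0.2.2 in
  If u (If (Op Leq (Op Mul N u.1) (Op Mul (Op Add N (Lit 1)) v.1))
          (Call DOM (MkPair N (MkPair u.2 v.2))) (Lit 0))
       (Lit 1).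
Definition ext_body :=
  let a := v0 in let j := (Var 1).1 in let r := (Var 1).2.1 in let x := (Var 1).2.2 in
  Let (Call NTH (MkPair v0.2.1 v0.2.2.1.2))
    (MkPair (MkPair (Op Add x.1.1 (Op Mul j.2.2 (Op Add a j.2.1)))
                    (Call UPD (MkPair r (MkPair x.1.2 (Op Add a j.2.1)))))
            (MkPair (MkPair j.1 a) x.2)).
Definition nth_body :=
  If v0.1 (Call NTH (MkPair (Op Sub v0.1 (Lit 1)) v0.2.2)) v0.2.1.
Definition upd_body :=
  let r := v0.1 in let l := v0.2.1 in let y := v0.2.2 in
  If r (MkPair l.1 (Call UPD (MkPair (Op Sub r (Lit 1)) (MkPair l.2 y)))) (MkPair y l.2).
Definition best_body :=
  If v0.2 (Let (Call BEST v0.2)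
             (If (Op Leq (Var 1).1.1.1 v0.1.1) (Var 1).1 v0))
          v0.1.
Definition out_body :=
  let i := v0.1 in let sol := v0.2.1 in let acc := v0.2.2 in
  If i (Call OUT (MkPair (Op Sub i (Lit 1)) (MkPair sol
          (MkPair (Call LOOKUP (MkPair (Op Sub i (Lit 1)) sol)) acc))))
       acc.
Definition lookup_body :=
  let i := v0.1 in let sol := v0.2 in
  If sol (If (Op Add (Op Sub sol.1.1 i) (Op Sub i sol.1.1)) (Call LOOKUP (MkPair i sol.2)) sol.1.2)
         (Lit 0).
Definition main_body :=
  (* The bindings are, in this order: the product of the denominators, the number of
     jobs, and the final list of states. *)
  Let (Call PROD v0)
  (Let (Call LEN (Var 1))
  (Let (Call DP (MkPair (Op Add (Op Mul v0 (Lit K.+1)) (Lit 1))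
          (MkPair (Call PREP (MkPair (Var 2) (MkPair (Lit 0) (Var 1))))
             (MkPair (MkPair (tuple_expr (map Lit (0 :: iota 0 m))) (Lit 0)) (Lit 0)))))
  (MkPair (Lit 1) (Call OUT (MkPair (Var 1) (MkPair (Call BEST v0).2 (Lit 0))))))).

Definition prog : program :=
  [:: main_body; len_body; prod_body; prep_body; ins_body; dp_body; stage_body;
      each_body; insert_body; covered_body; dom_body; ext_body; nth_body; upd_body;
      best_body; out_body; lookup_body].

End ProgramText.

Section ProgramCorrect.
Variables (m K : nat).
Local Notation prog := (prog m K).

(** * Correctness and cost of the functions *)

Definition enc_nats (v : seq nat) := enc_seq [seq Num a | a <- v].
Definition enc_starts (s : seq (nat * nat)) := enc_seq [seq Pair (Num e.1) (Num e.2) | e <- s].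
Definition enc_state (x : seq nat * seq (nat * nat)) := Pair (enc_nats x.1) (enc_starts x.2).
Definition enc_states X := enc_seq (map enc_state X).

(* B bounds the bit length of every number that occurs.  The factor 60
   leaves room for the instructions of one function body, so that the costs of calls
   can be counted in multiples of U. *)
Variables B U : nat.
Hypothesis le_BU : 60 * B <= U.

Definition small a := bitlen a <= B.

Hypothesis small_m : small m.

Lemma B_gt0 : 0 < B.
Proof. exact: leq_trans (small_m). Qed.

Lemma small_le a b : a <= b -> small b -> small a.
Proof. by move=> /leq_bitlen; apply: leq_trans. Qed.

Ltac costs := have ? := B_gt0; have ? := le_BU; rewrite ?bitlen0 ?bitlen1 /binop_sem /=; unfold small in *; lia.

Lemma nth_ok r l : r < size l -> small r ->
  calls prog NTH (Pair (Num r) (enc_nats l)) (Num (nth 0 l r)) (r.+1 * U).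
Proof.
elim: r l => [|r IH] [|a l] // rl sr.
  by eapply ev_conv; [eapply ev_if; [evs | rewrite /=; evs] | by [] | costs].
eapply ev_conv; [eapply ev_if; [evs | rewrite /=; eapply ev_call; [by [] | evs | ]] | | ].
- by rewrite /= subn1; apply: IH => //; apply: small_le sr.
- by [].
- costs.
Qed.

Lemma upd_ok r l y : r < size l -> small r ->
  calls prog UPD (Pair (Num r) (Pair (enc_nats l) (Num y))) (enc_nats (set_nth 0 l r y)) (r.+1 * U).
Proof.
elim: r l => [|r IH] [|a l] // rl sr.
  by eapply ev_conv; [eapply ev_if; [evs | rewrite /=; evs] | by [] | costs].
eapply ev_conv; [eapply ev_if; [evs | rewrite /=; evs; eapply ev_call; [by [] | evs | ]] | | ].
- by rewrite /= subn1; apply: IH => //; apply: small_le sr.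
- by [].
- costs.
Qed.

Lemma len_ok (T : Type) (f : T -> val) l : small (size l) ->
  calls prog LEN (enc_seq (map f l)) (Num (size l)) ((size l).+1 * U).
Proof.
elim: l => [|a l IH] sl.
  by eapply ev_conv; [eapply ev_if; [evs | rewrite /=; evs] | by [] | costs].
have sl' : small (size l) by apply: small_le sl.
eapply ev_conv; [eapply ev_if; [evs | rewrite /=; evs; eapply ev_call; [by [] | evs | exact: IH]] | | ].
- by [].
- rewrite /=; costs.
Qed.

Lemma lookup_ok i s : small i -> all (fun e => small e.1) s ->
  calls prog LOOKUP (Pair (Num i) (enc_starts s)) (Num (lookup i s)) ((size s).+1 * U).
Proof.
move=> si; elim: s => [_|[k t] s IH /andP [sk /IH {}IH]].
  by eapply ev_conv; [eapply ev_if; [evs | rewrite /=; evs] | by [] | costs].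
rewrite /= in sk; have sd : small (k - i) /\ small (i - k) by split; [apply: small_le sk | apply: small_le si]; apply: leq_subr.
case: sd => sd1 sd2.
have z : is_zero (Num (binop_sem Add (binop_sem Sub k i) (binop_sem Sub i k))) = (k == i).
  by rewrite /binop_sem eqn_leq -!subn_eq0; case: (k - i); case: (i - k).
case: eqVneq z => [ki|ki] z.
  eapply ev_conv; [eapply ev_if; [evs | rewrite [is_zero _]/=; eapply ev_if; [evs | rewrite z; evs]] | by rewrite /= ki eqxx | ].
  costs.
eapply ev_conv; [eapply ev_if; [evs | rewrite [is_zero _]/=; eapply ev_if; [evs | rewrite z]] | | ].
- by eapply ev_call; [by [] | evs | exact: IH].
- by rewrite /= (negbTE ki).
- costs.
Qed.

Lemma out_ok i s acc : small i -> all (fun e => small e.1) s ->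
  calls prog OUT (Pair (Num i) (Pair (enc_starts s) (enc_nats acc)))
    (enc_nats ([seq lookup k s | k <- iota 0 i] ++ acc)) (i.+1 * ((size s).+1 * U + U)).
Proof.
move=> si ss; elim: i si acc => [|i IH] si acc.
  by eapply ev_conv; [eapply ev_if; [evs | rewrite /=; evs] | by [] | costs].
have si' : small i by apply: small_le si.
have ei : binop_sem Sub i.+1 1 = i by rewrite /= subn1.
eapply ev_conv; [eapply ev_if; [evs | rewrite /=; eapply ev_call; [by [] | evs | ]] | | ].
- by eapply ev_call; [by [] | evs | rewrite ei; exact: lookup_ok].
- by rewrite ei; apply: (IH si' (lookup i s :: acc)).
- by rewrite -addn1 iotaD map_cat -catA.
- costs.
Qed.

Lemma dom_ok N u v : small N -> small N.+1 -> size u = size v ->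
  all (fun a => small (N.+1 * a)) u -> all (fun a => small (N.+1 * a)) v ->
  calls prog DOM (Pair (Num N) (Pair (enc_nats u) (enc_nats v))) (Num (dominates N u v))
    ((size u).+1 * U).
Proof.
move=> sN sN1; elim: u v => [|a u IH] [|b v] //.
  by move=> _ _ _; eapply ev_conv; [eapply ev_if; [evs | rewrite /=; evs] | by [] | costs].
move=> [suv] /= /andP [sa au] /andP [sb av].
have sNa : small (N * a) by apply: small_le sa; rewrite leq_mul2r leqnSn orbT.
have sa' : small a by apply: small_le sa; rewrite leq_pmull.
have sb' : small b by apply: small_le sb; rewrite leq_pmull.
have eN : binop_sem Add N 1 = N.+1 by rewrite /= addn1.
case: (leqP (N * a) (N.+1 * b)) => [le|gt].
  eapply ev_conv; [eapply ev_if; [evs | rewrite [is_zero _]/=; eapply ev_if; [evs | ]] | | ].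
  - rewrite /binop_sem addn1 le [is_zero _]/=.
    by eapply ev_call; [by [] | evs | apply: (IH v)].
  - by rewrite /dominates /=.
  - rewrite eN; costs.
eapply ev_conv; [eapply ev_if; [evs | rewrite [is_zero _]/=; eapply ev_if; [evs | ]] | | ].
- by rewrite /binop_sem addn1 leqNgt gt [is_zero _]/=; evs.
- by rewrite /dominates /=.
- rewrite eN; costs.
Qed.

(** All comparisons of [dominates] then have operands of at most B bits. *)
Definition ok N (v : seq nat) := (size v == m.+1) && all (fun a => small (N.+1 * a)) v.

Lemma covered_ok N v acc : small N -> small N.+1 -> ok N v -> all (ok N) (map fst acc) ->
  calls prog COVERED (Pair (Num N) (Pair (enc_nats v) (enc_states acc))) (Num (covered N v acc))
    ((size acc).+1 * (m.+3 * U)).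
Proof.
move=> sN sN1 okv; elim: acc => [_|x acc IH /andP [okx /IH {}IH]].
  by eapply ev_conv; [eapply ev_if; [evs | rewrite /=; evs] | by [] | costs].
have [/eqP sx ax] := andP okx; have [/eqP sv av] := andP okv.
have d := @dom_ok N x.1 v sN sN1 (etrans sx (esym sv)) ax av.
case dx : (dominates N x.1 v) d => d.
  eapply ev_conv; [eapply ev_if; [evs | rewrite [is_zero _]/=; eapply ev_if; [|]] | | ].
  - by eapply ev_call; [by [] | evs | exact: d].
  - by rewrite /=; evs.
  - by rewrite /covered /= dx.
  - rewrite sx; costs.
eapply ev_conv; [eapply ev_if; [evs | rewrite [is_zero _]/=; eapply ev_if; [|]] | | ].
- by eapply ev_call; [by [] | evs | exact: d].
- by rewrite /=; eapply ev_call; [by [] | evs | exact: IH].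
- by rewrite /covered /= dx.
- rewrite sx; costs.
Qed.

Lemma insert_ok N x acc : small N -> small N.+1 -> ok N x.1 -> all (ok N) (map fst acc) ->
  calls prog INSERT (Pair (Num N) (Pair (enc_state x) (enc_states acc)))
    (enc_states (add_state N x acc)) ((size acc).+2 * (m.+3 * U)).
Proof.
move=> sN sN1 okx oka; have c := covered_ok sN sN1 okx oka.
rewrite /add_state; case: (covered N x.1 acc) c => c.
  eapply ev_conv; [eapply ev_if; [|] | | ].
  - by eapply ev_call; [by [] | evs | exact: c].
  - by rewrite /=; evs.
  - by [].
  - costs.
eapply ev_conv; [eapply ev_if; [|] | | ].
- by eapply ev_call; [by [] | evs | exact: c].
- by rewrite /=; evs.
- by [].
- costs.
Qed.

Variables (J : finType) (w p key loops num den : J -> nat).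
Definition enc_job j := Pair (Num (key j)) (Pair (Num (p j)) (Num (w j))).
Definition enc_jobs s := enc_seq (map enc_job s).
Definition enc_raw j := Pair (Num (loops j)) (Pair (Num (num j)) (Num (den j))).

Hypothesis small_p : forall j, small (p j).
Hypothesis small_w : forall j, small (w j).
Hypothesis small_wp : forall i j, small (w i * p j).
Hypothesis small_key : forall j, small (key j).
Hypothesis small_loops : forall j, small (loops j).
Hypothesis small_num : forall j, small (num j).
Hypothesis small_den : forall j, small (den j).
Hypothesis den_gt0 : forall j, 0 < den j.

Notation extend := (extend w p key).

Lemma ext_ok N j r x : small N.+1 -> r < m -> ok N x.1 -> ok N (extend j r x).1 ->
  calls prog EXT (Pair (enc_job j) (Pair (Num r) (enc_state x))) (enc_state (extend j r x))
    (2 * m.+1 * U).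
Proof.
case: x => [[|z ts] sol] sN rm; rewrite /ok //= => /andP [/eqP [szt] /andP [sz sts]].
have rt : r < size ts by rewrite szt.
have sm a : small (N.+1 * a) -> small a by apply: small_le; rewrite leq_pmull.
move=> /andP [_ /andP []]; set z' := z + _ => /sm sz'.
have sr : small r by apply: small_le small_m; apply: ltnW.
move/(all_nthP 0) => /(_ r); rewrite size_set_nth nth_set_nth /= eqxx leq_max ltnSn => /(_ isT)/sm sap.
have sa : small (nth 0 ts r) by apply: small_le sap; apply: leq_addr.
have sws : small (w j * (nth 0 ts r + p j)) by apply: small_le sz'; apply: leq_addl.
have szz := sm _ sz; have spj := small_p j; have swj := small_w j.
have rmU : r.+1 * U <= m * U by rewrite leq_mul2r rm orbT.
eapply ev_conv; [eapply ev_let; [|evs] | | ].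
- by eapply ev_call; [by [] | evs | apply: nth_ok].
- by eapply ev_call; [by [] | evs | apply: upd_ok].
- by [].
- costs.
Qed.

Section FixedN.
Variables (N Q : nat).
Hypothesis small_N : small N.
Hypothesis small_N1 : small N.+1.
Let antichain := pairwise (fun u v => ~~ dominates N v u).
Hypothesis antichain_le : forall V, all (ok N) V -> antichain V -> size V <= Q.

Notation each := (each w p key N).
Notation stage := (stage w p key m N).
Notation dp := (dp w p key m N).

(** Carried through all loops, because the cost of examining one state is proportional
    to the number of retained states. *)
Definition nice (X : seq (seq nat * seq (nat * nat))) :=
  all (ok N) (map fst X) /\ antichain (map fst X).

Lemma nice_size X : nice X -> size X <= Q.
Proof. by move=> [okX aX]; rewrite -(size_map fst) antichain_le. Qed.

(** A state is added only if no retained state dominates it, so the list remains an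
    antichain in the sense of [antichain_size]. *)
Lemma nice_add_state x acc : ok N x.1 -> nice acc -> nice (add_state N x acc).
Proof.
move=> okx [oka aa]; rewrite /add_state; case: ifP => [_|/negbT nc]; first by split.
split; rewrite /= ?okx //; apply/andP; split=> //.
by rewrite all_map; move: nc; rewrite /covered -all_predC.
Qed.

Let each_unit := Q.+2 * m.+3 * U + 2 * m.+2 * U.

Lemma each_ok j x r acc : r <= m -> ok N x.1 ->
  (forall r', r' < m -> ok N (extend j r' x).1) -> nice acc ->
  nice (each j x r acc) /\
  calls prog EACH (Pair (Num N) (Pair (enc_job j) (Pair (enc_state x) (Pair (Num r) (enc_states acc)))))
    (enc_states (each j x r acc)) (r.+1 * each_unit).
Proof.
move=> rm okx oke; rewrite /each_unit; elim: r rm acc => [|r IH] rm acc na.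
  split=> //.
  by eapply ev_conv; [eapply ev_if; [evs | rewrite /=; evs] | by [] | costs].
have okr := oke r rm.
have [nr cr] := IH (ltnW rm) _ (nice_add_state okr na); split => //.
have sr : small r.+1 by apply: small_le small_m.
have er : binop_sem Sub r.+1 1 = r by rewrite /= subn1.
have le : (size acc).+2 * (m.+3 * U) <= Q.+2 * m.+3 * U.
  by rewrite mulnA !leq_mul2r !ltnS nice_size ?orbT.
eapply ev_conv; [eapply ev_if; [evs | rewrite [is_zero _]/=; eapply ev_call; [by [] | evs | ]] | | ].
- eapply ev_call; [by [] | evs | ].
    by eapply ev_call; [by [] | evs | rewrite er; apply: (@ext_ok N)].
  by apply: insert_ok => //; case: na.
- rewrite er; exact: cr.
- by [].
- move: le; set x1 := _ * (_ * U); set x2 := _ * m.+3 * U => le; costs.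
Qed.

Lemma stage_ok j X acc : (forall x, x \in X -> ok N x.1) ->
  (forall x r, x \in X -> r < m -> ok N (extend j r x).1) -> nice acc ->
  nice (stage j X acc) /\
  calls prog STAGE (Pair (Num N) (Pair (enc_job j) (Pair (enc_states X) (enc_states acc))))
    (enc_states (stage j X acc)) ((size X).+1 * (m.+1 * each_unit + U)).
Proof.
elim: X acc => [|x X IH] acc okX oke na.
  split=> //.
  by eapply ev_conv; [eapply ev_if; [evs | rewrite /=; evs] | by [] | costs].
have xX := mem_head x X.
have [ne ce] := each_ok (leqnn m) (okX x xX) (fun r => oke x r xX) na.
have [||ns cs] := IH _ _ _ ne.
- by move=> y yX; apply: okX; rewrite inE yX orbT.
- by move=> y r yX; apply: oke; rewrite inE yX orbT.
split=> //.
eapply ev_conv; [eapply ev_if; [evs | rewrite [is_zero _]/=; eapply ev_call; [by [] | evs | ]] | | ].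
- by eapply ev_call; [by [] | evs | exact: ce].
- exact: cs.
- by [].
- costs.
Qed.

Hypothesis key_inj : injective key.
Hypothesis m_gt0 : 0 < m.
Hypothesis p_mod : forall j, p j = 0 %[mod m].
Hypothesis consistent_ok : forall s x, uniq s -> consistent w p key m s x -> ok N x.1.

Lemma dp_ok s1 s2 X : uniq (s1 ++ s2) -> (forall x, x \in X -> consistent w p key m s1 x) -> nice X ->
  nice (dp s2 X) /\
  calls prog DP (Pair (Num N) (Pair (enc_jobs s2) (enc_states X)))
    (enc_states (dp s2 X)) ((size s2).+1 * (Q.+1 * (m.+1 * each_unit + U) + U)).
Proof.
elim: s2 s1 X => [|j s2 IH] s1 X.
  split=> //.
  by eapply ev_conv; [eapply ev_if; [evs | rewrite /=; evs] | by [] | costs].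
rewrite -cat_rcons => us cX nX.
have us1 : uniq (rcons s1 j) by move: us; rewrite cat_uniq => /andP [].
have js1 : j \notin s1 by move: us1; rewrite rcons_uniq => /andP [].
have ext x r : x \in X -> r < m -> consistent w p key m (rcons s1 j) (extend j r x).
  by move=> xX rm; apply: consistent_extend => //; apply: cX.
have [|||ns cs] := @stage_ok j X [::].
- by move=> x /cX; apply: consistent_ok; move: us1; rewrite rcons_uniq => /andP [].
- by move=> x r xX rm; apply: (consistent_ok us1); apply: ext.
- by [].
have [|nd cd] := IH (rcons s1 j) _ us _ ns.
  by apply: stage_ind.
split=> //.
have le : (size X).+1 * (m.+1 * each_unit + U) <= Q.+1 * (m.+1 * each_unit + U).
  by rewrite leq_mul2r ltnS nice_size ?orbT.
eapply ev_conv; [eapply ev_if; [evs | rewrite [is_zero _]/=; eapply ev_call; [by [] | evs | ]] | | ].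
- by eapply ev_call; [by [] | evs | exact: cs].
- exact: cd.
- by [].
- move: le; set x1 := _ * (_ + U); set x2 := Q.+1 * _ => le; costs.
Qed.

Lemma best_ok X x : all (ok N) (map fst (x :: X)) ->
  calls prog BEST (enc_states (x :: X)) (enc_state (best X x)) ((size X).+1 * U).
Proof.
have hd (y : seq nat * seq (nat * nat)) : ok N y.1 -> exists z ts, y.1 = z :: ts /\ small z.
  move=> /andP []; case: (y.1) => // z ts _ /= /andP [sz _]; exists z, ts; split=> //.
  by apply: small_le sz; rewrite leq_pmull.
elim: X x => [|x' X IH] x.
  by move=> _; eapply ev_conv; [eapply ev_if; [evs | rewrite /=; evs] | by [] | costs].
move=> /andP [okx okX].
have {okX} okX : all (ok N) (map fst (x' :: X)) by exact: okX.
have {}IH := IH _ okX.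
have okb : ok N (best X x').1 by have /allP := okX; apply; exact: map_f (best_mem X x').
have [z [ts [ez sz]]] := hd _ okx; have [z' [ts' [ez' sz']]] := hd _ okb.
have eb : enc_state (best X x') = Pair (Pair (Num z') (enc_nats ts')) (enc_starts (best X x').2).
  by rewrite /enc_state ez'.
have ex : enc_states (x :: x' :: X) =
    Pair (Pair (Pair (Num z) (enc_nats ts)) (enc_starts x.2)) (enc_states (x' :: X)).
  by rewrite /enc_states /= /enc_state ez.
rewrite eb in IH; rewrite ex.
case le : (z <= z').
  eapply ev_conv; [eapply ev_if; [evs | rewrite [is_zero _]/=; eapply ev_let; [|eapply ev_if; [evs|]]] | | ].
  - by eapply ev_call; [by [] | evs | exact: IH].
  - by rewrite /binop_sem le [is_zero _]/=; evs.
  - by rewrite /= ez ez' /= le /enc_state ez.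
  - costs.
eapply ev_conv; [eapply ev_if; [evs | rewrite [is_zero _]/=; eapply ev_let; [|eapply ev_if; [evs|]]] | | ].
- by eapply ev_call; [by [] | evs | exact: IH].
- by rewrite /binop_sem le [is_zero _]/=; evs.
- by rewrite /= ez ez' /= le eb.
- costs.
Qed.

End FixedN.

Lemma ins_ok j l :
  calls prog INS (Pair (enc_job j) (enc_jobs l)) (enc_jobs (ins w p j l)) ((size l).+1 * U).
Proof.
elim: l => [|i l IH].
  by eapply ev_conv; [eapply ev_if; [evs | rewrite /=; evs] | by [] | costs].
have := (small_p i, small_p j, small_w i, small_w j, small_wp i j, small_wp j i).
move=> [[[[[? ?] ?] ?] ?] ?].
case le : (w i * p j <= w j * p i).
  eapply ev_conv; [eapply ev_if; [evs | rewrite [is_zero _]/=; eapply ev_if; [evs|]] | | ].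
  - by rewrite /binop_sem le [is_zero _]/=; evs.
  - by rewrite /= /smith le.
  - costs.
eapply ev_conv; [eapply ev_if; [evs | rewrite [is_zero _]/=; eapply ev_if; [evs|]] | | ].
- by rewrite /binop_sem le [is_zero _]/=; evs; eapply ev_call; [by [] | evs | exact: IH].
- by rewrite /= /smith le.
- costs.
Qed.

Lemma prod_ok l : small (\prod_(j <- l) den j) ->
  calls prog PROD (enc_seq (map enc_raw l)) (Num (\prod_(j <- l) den j)) ((size l).+1 * U).
Proof.
elim: l => [_|j l IH].
  by eapply ev_conv; [eapply ev_if; [evs | rewrite /=; evs] | by rewrite big_nil | costs].
rewrite big_cons => sP; have ? := small_den j.
have sl : small (\prod_(i <- l) den i) by apply: small_le sP; apply: leq_pmull.
eapply ev_conv; [eapply ev_if; [evs | rewrite /=; evs; eapply ev_call; [by [] | evs | exact: IH]] | | ].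
- by [].
- costs.
Qed.

Lemma prep_ok D i l : small D -> (forall j, p j = m * loops j) ->
  (forall j, w j = num j * (D %/ den j)) -> map key l = iota i (size l) ->
  calls prog PREP (Pair (enc_seq (map enc_raw l)) (Pair (Num i) (Num D)))
    (enc_jobs (isort w p l)) ((size l).+1 * ((size l).+1 * U + U)).
Proof.
move=> sD ep ew; elim: l i => [|j l IH] i el.
  by eapply ev_conv; [eapply ev_if; [evs | rewrite /=; evs] | by [] | costs].
case: el => ej el; have {}IH := IH _ el.
have := (small_loops j, small_num j, small_den j, small_key j); rewrite ej => -[[[? ?] ?] ?].
have sq : small (D %/ den j) by apply: small_le sD; apply: leq_div.
have si : size (isort w p l) = size l by apply: perm_size; apply: perm_isort.
have ei : binop_sem Add i 1 = i.+1 by rewrite /= addn1.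
eapply ev_conv; [eapply ev_if; [evs | rewrite [is_zero _]/=; eapply ev_call; [by [] | evs | ]] | | ].
- by eapply ev_call; [by [] | evs | rewrite ei; exact: IH].
- have -> : Pair (Num i) (Pair (Num (binop_sem Mul m (loops j)))
      (Num (binop_sem Mul (num j) (binop_sem Div D (den j))))) = enc_job j.
    by rewrite /enc_job -ej ep ew.
  exact: ins_ok.
- by [].
- rewrite si; costs.
Qed.

Lemma tuple_ok env v : all small v ->
  ev prog env (tuple_expr (map Lit v)) (enc_nats v) ((size v).+1 * U).
Proof.
elim: v => [|a v IH] /=; first by move=> _; eapply ev_conv; [evs | by [] | costs].
move=> /andP [sa /IH {}IH].
by eapply ev_conv; [eapply ev_pair; [evs | exact: IH] | by [] | costs].
Qed.

Lemma vsize_nats v : all small v -> vsize (enc_nats v) <= (size v).+1 * U.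
Proof.
elim: v => [_|a v IH /andP [sa /IH {}IH]]; first by rewrite -[vsize _]/(bitlen 0); costs.
by rewrite -[vsize _]/((bitlen a + vsize (enc_nats v)).+1); costs.
Qed.

(** In units of U = 60 B: evaluation of [main_body] and size of the output, for n jobs
    and at most Q states. *)
Definition main_cost n Q :=
  (4 * n.+2 + m.+3 + 2 * (n.+2 * n.+2) + Q.+1) * U
  + n.+1 * (Q.+1 * (m.+1 * (Q.+2 * m.+3 * U + 2 * m.+2 * U) + U) + U).

Section Main.
Variables (l : seq J) (Q : nat).
Let n := size l.
Let N := n * K.+1 + 1.
Let D := \prod_(j <- l) den j.
Let s := isort w p l.
Hypothesis key_inj : injective key.
Hypothesis m_gt0 : 0 < m.
Hypothesis uniq_l : uniq l.
Hypothesis key_l : map key l = iota 0 n.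
Hypothesis p_def : forall j, p j = m * loops j.
Hypothesis w_def : forall j, w j = num j * (D %/ den j).
Hypothesis small_n : small n.
Hypothesis small_K : small K.+1.
Hypothesis small_D : small D.
Hypothesis small_N1 : small N.+1.
Hypothesis antichain_le : forall V, all (ok N) V ->
  pairwise (fun u v => ~~ dominates N v u) V -> size V <= Q.
Hypothesis consistent_ok : forall t x, uniq t -> consistent w p key m t x -> ok N x.1.

Lemma main_ok : exists x X, dp w p key m N s [:: init_state m] = x :: X /\
  exists y t, [/\ runs prog (enc_seq (map enc_raw l)) y t,
    y = Pair (Num 1) (enc_nats [seq lookup k (best X x).2 | k <- iota 0 n])
    & t <= main_cost n Q].
Proof.
have small_N : small N by apply: small_le small_N1.
have p_mod j : p j = 0 %[mod m] by rewrite p_def mod0n modnMr.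
have ps : perm_eq s l := perm_isort w p l.
have us : uniq s by rewrite (perm_uniq ps).
have ss : size s = n := perm_size ps.
have cI y : y \in [:: init_state m] -> consistent w p key m [::] y.
  by rewrite inE => /eqP ->; apply: consistent_init.
have okI : ok N (init_state m).1 by apply: (@consistent_ok [::]) => //; exact: cI (mem_head _ _).
have nI : nice N [:: init_state m] by split; rewrite /= ?okI.
have [[okX aX] cX] := @dp_ok N Q small_N small_N1 antichain_le key_inj m_gt0 p_mod consistent_ok
  [::] s [:: init_state m] us cI nI.
have := @dp_consistent J w p key m key_inj m_gt0 p_mod N [::] s [:: init_state m] us cI.
have := @dp_neq0 J w p key m m_gt0 N s [:: init_state m] isT.
case eX : (dp w p key m N s [:: init_state m]) okX aX cX => [|x X] // okX aX cX _ consX.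
exists x, X; split=> //.
have okb := consistent_ok us (consX _ (best_mem X x)).
have [ts [eb szt _ [ks kend _]]] := consX _ (best_mem X x).
set b := best X x in eb okb ks kend *.
have sb : size b.2 = n by rewrite -(size_map fst) ks size_rev size_map.
have small_keys : all (fun e => small e.1) b.2.
  by rewrite -(all_map fst (fun k => small k)) ks all_rev all_map; apply/allP => j _ /=.
have small_starts : all small [seq lookup k b.2 | k <- iota 0 n].
  rewrite -key_l -map_comp all_map; apply/allP => j jl.
  have js : j \in [::] ++ s by rewrite (perm_mem ps).
  have lt : nth 0 ts (lookup (key j) b.2 %% m) \in b.1.
    by rewrite eb inE mem_nth ?orbT // szt ltn_mod.
  have /andP [_ /allP /(_ _ lt)] := okb.
  apply: small_le; apply: leq_trans (leq_pmull _ _) => //.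
  exact: leq_trans (leq_addr _ _) (kend j js).
have small_nK : small (n * K.+1) by apply: small_le small_N; apply: leq_addr.
have sl : size l = n by [].
have cP := prod_ok small_D; have cL := len_ok enc_raw small_n.
have cR := prep_ok small_D p_def w_def key_l; rewrite sl in cR.
have cB : calls prog BEST (enc_states (x :: X)) (enc_state b) ((size X).+1 * U).
  by apply: best_ok okX.
have := out_ok [::] small_n small_keys; rewrite sb cats0 => cO.
have cT env : ev prog env (tuple_expr (map Lit (iota 0 m))) (enc_nats (iota 0 m)) (m.+1 * U).
  rewrite -[m in m.+1](size_iota 0); apply: tuple_ok; apply/allP => k.
  by rewrite mem_iota => /andP [_ lt]; apply: small_le small_m; apply: ltnW.
have lX : size (x :: X) <= Q by rewrite -(size_map fst) antichain_le.
have cM : calls prog MAIN (enc_seq (map enc_raw l))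
    (Pair (Num 1) (enc_nats [seq lookup k b.2 | k <- iota 0 n]))
    ((3 * n.+2 + m.+2 + 2 * (n.+2 * n.+2) + Q.+1) * U
      + n.+1 * (Q.+1 * (m.+1 * (Q.+2 * m.+3 * U + 2 * m.+2 * U) + U) + U)).
  eapply ev_conv.
  - eapply ev_let; [by eapply ev_call; [by [] | evs | exact: cP]|].
    eapply ev_let; [by eapply ev_call; [by [] | evs | exact: cL]|].
    eapply ev_let.
      eapply ev_call; [by [] | evs | ].
      + by eapply ev_call; [by [] | evs | exact: cR].
      + exact: cT.
      + exact: cX.
    evs; eapply ev_call; [by [] | evs | ].
      by eapply ev_call; [by [] | evs | exact: cB].
    exact: cO.
  - by [].
  - rewrite ss sl; move: (Q.+1 * (m.+1 * _ + _) + U) => dpc.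
    have : (size X).+1 * U <= Q * U by rewrite leq_mul2r lX orbT.
    move: small_nK small_n small_K; costs.
have vy : vsize (Pair (Num 1) (enc_nats [seq lookup k b.2 | k <- iota 0 n])) <= n.+2 * U.
  rewrite -[vsize _]/((bitlen 1 + vsize (enc_nats [seq lookup k b.2 | k <- iota 0 n])).+1).
  have := vsize_nats small_starts; rewrite size_map size_iota; costs.
have cV : ev prog [:: enc_seq (map enc_raw l)] (Var 0) (enc_seq (map enc_raw l)) 1 by evs.
have [c cE cle] := ev_call (isT : MAIN < size prog) cV cM.
eexists _, _; split; first by exists c; [exact: cE | reflexivity].
  by [].
apply: leq_trans (leq_add cle vy) _; rewrite /main_cost.
by move: (Q.+1 * (m.+1 * _ + _) + U) => dpc; costs.
Qed.
End Main.

End ProgramCorrect.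

(** * Reentrant schedules and assignments of jobs to machines *)

Section ScheduleBounds.
Variables (m : nat) (I : rfs_inst).
Hypothesis m_gt0 : 0 < m.
Notation J := 'I_(njobs I).
Variable w : J -> nat.
Let p (j : J) := m * loops j.

Lemma p_gt0 j : 0 < p j.
Proof. by rewrite muln_gt0 m_gt0 loops_gt0. Qed.

Section LowerBound.
Variable S : schedule I.
Hypothesis feas : rfs_feasible m S.

Let busy s (j : J) (k : nat) := S j k.+1 <= s < S j k.+1 + m.
Definition running s := [seq j <- enum J | [exists k : 'I_(loops j), busy s j k]].

Lemma start_step (j : J) k : k.+1 < loops j -> S j k.+1 + m <= S j k.+2.
Proof. by move=> lt; apply: (proj2 feas j k.+2); rewrite /is_loop /=. Qed.

Lemma start_mono (j : J) k k' : k < k' -> k' < loops j -> S j k.+1 + m <= S j k'.+1.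
Proof.
elim: k' => // k' IH; rewrite ltnS leq_eqVlt => /orP [/eqP ->|kk'] lt; first exact: start_step.
apply: leq_trans (IH kk' (ltnW lt)) _.
by apply: leq_trans (start_step lt); rewrite leq_addr.
Qed.

Lemma start_last (j : J) k : k < loops j -> S j k.+1 <= S j (loops j).
Proof.
move=> lt; have l0 := loops_gt0 j; rewrite -(prednK l0).
have : k <= (loops j).-1 by rewrite -ltnS prednK.
rewrite leq_eqVlt => /orP [/eqP -> //|kl]; apply: leq_trans (start_mono kl _).
  exact: leq_addr.
by rewrite prednK.
Qed.

Lemma running_lt s j : j \in running s -> s < completion m S j.
Proof.
rewrite mem_filter => /andP [/existsP [k /andP [_ lt]] _].
by apply: leq_trans lt _; rewrite leq_add2r start_last.
Qed.

Lemma running_uniq s : uniq (running s).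
Proof. by apply: filter_uniq; apply: enum_uniq. Qed.

(** The elapsed time of the loop in progress at time s identifies the job, since start
    times are distinct; it is at most s and less than m. *)
Lemma size_running s : size (running s) <= #|[pred r : 'I_m | r <= s]|.
Proof.
pose g j := if [pick k : 'I_(loops j) | busy s j k] is Some k then s - S j k.+1 else 0.
have gP j : j \in running s -> exists2 k : 'I_(loops j), busy s j k & g j = s - S j k.+1.
  rewrite mem_filter => /andP [/existsP ex _]; rewrite /g; case: pickP => [k bk|no].
    by exists k.
  by case: ex => k; rewrite no.
rewrite -(size_map g) cardE -(size_map (@nat_of_ord m)); apply: uniq_leq_size.
  rewrite map_inj_in_uniq ?running_uniq // => i j /gP [k /andP [b1 b2] ->] /gP [k' /andP [b1' b2'] ->].
  move=> e; have es : S i k.+1 = S j k'.+1 by lia.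
  by case: (proj1 feas i k.+1 j k'.+1 _ _ es); rewrite // /is_loop /=.
move=> _ /mapP [j /gP [k /andP [b1 b2] ->] ->].
have lt : s - S j k.+1 < m by lia.
by apply/mapP; exists (Ordinal lt) => //; rewrite mem_enum inE /= leq_subr.
Qed.

Lemma sum_window T a : a + m <= T -> \sum_(0 <= s < T) (a <= s < a + m) = m.
Proof.
move=> le; rewrite (big_cat_nat (n := a)) //=; last by apply: leq_trans le; apply: leq_addr.
rewrite (big_cat_nat (n := a + m) (m := a)) //= ?leq_addr //.
rewrite big_nat big1 => [|s /andP [_ lt]]; last by rewrite leqNgt lt.
rewrite [X in _ + (_ + X)]big_nat [X in _ + (_ + X)]big1 => [|s /andP [ge _]]; last first.
  by rewrite ltnNge ge andbF.
rewrite add0n addn0 (eq_big_nat _ _ (F2 := fun=> 1)) => [|s ->] //.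
by rewrite sum_nat_const_nat muln1 addKn.
Qed.

(** The loops of j occupy disjoint windows of length m. *)
Lemma sum_running T j : completion m S j <= T -> \sum_(0 <= s < T) (j \in running s) = p j.
Proof.
move=> le; rewrite (eq_bigr (fun s => \sum_(k < loops j) (busy s j k : nat))); last first.
  move=> s _; rewrite mem_filter mem_enum andbT.
  case: existsP => [[k bk]|no]; last by rewrite big1 // => k _; case bk: busy => //; case: no; exists k.
  rewrite (bigD1 k) //= bk big1 // => k' kk'; rewrite /busy.
  move/andP: bk => [b1 b2]; case: (ltngtP k k') => [lt|lt|/val_inj e].
  - by have := start_mono lt (ltn_ord k'); case: leqP => //=; lia.
  - by have := start_mono lt (ltn_ord k); case: ltnP => //=; rewrite ?andbF //; lia.
  - by rewrite e eqxx in kk'.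
rewrite exchange_big /= (eq_bigr (fun=> m)) ?sum_nat_const ?card_ord 1?mulnC // => k _.
by apply: sum_window; apply: leq_trans le; rewrite leq_add2r start_last.
Qed.

(** The shop schedule S, viewed as a preemptive parallel machine schedule, is beaten by
    an assignment. *)
Lemma schedule_ge_assignment s : pairwise (smith w p) s -> perm_eq s (enum J) ->
  exists f : {ffun J -> 'I_m},
    \sum_(r < m) wct w p r [seq j <- s | f j == r] <= \sum_j w j * completion m S j.
Proof.
move=> ps es; pose T := \max_j completion m S j.
have [|||L ar c] := @nonpreemptive_wins _ w m running (completion m S) T.
- exact: running_uniq.
- exact: size_running.
- exact: running_lt.
have ep : (fun j => \sum_(0 <= s < T) (j \in running s)) =1 p.
  by move=> j; apply: sum_running; apply: leq_bigmax.
have [f cf] := smith_assignment p_gt0 (fun r => r) ps es (eq_arranged ep ar).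
exists f; apply: leq_trans cf _; rewrite -(eq_total_wct _ _ ep (fun=> erefl)).
apply: leq_trans c _; rewrite [X in _ <= X](bigID (fun j => 0 < \sum_(0 <= s < T) (j \in running s))) /=.
exact: leq_addr.
Qed.

End LowerBound.

Section UpperBound.
Variables (s : seq J) (x : seq nat * seq (nat * nat)).
Hypothesis perm_s : perm_eq s (enum J).
Hypothesis cons : consistent w p (@nat_of_ord _) m s x.

Definition sched : schedule I := fun j k => lookup j x.2 + m * k.-1.

Lemma sched_uninterrupted : uninterrupted m sched.
Proof.
move=> j k _; case: k => [|[|k]] // _; rewrite /loop_completion /sched /=.
by rewrite -addnA mulnS (addnC m).
Qed.

Lemma sched_feasible : rfs_feasible m sched.
Proof.
have [ts [_ _ _ [_ _ disj]]] := cons.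
split=> [j k j' k'|j k jk k2]; last by rewrite (sched_uninterrupted jk k2).
have ins j0 : j0 \in s by rewrite (perm_mem perm_s) mem_enum.
rewrite /is_loop /sched => /andP [k0 kl] /andP [k0' kl'] e.
have lt i l : 0 < l <= loops i -> m * l.-1 < p i.
  by case: l => //= l le; rewrite ltn_pmul2l.
case: (eqVneq j j') => [jj|jj].
  split=> //; move: e; rewrite -jj => /addnI/eqP; rewrite eqn_pmul2l // => /eqP e.
  by rewrite -(prednK k0) -(prednK k0') e.
have em : lookup j x.2 = lookup j' x.2 %[mod m].
  have := congr1 (modn^~ m) e.
  by rewrite ![m * _]mulnC ![lookup _ _ + _]addnC !modnMDl.
have := lt j k; have := lt j' k'; rewrite k0 kl k0' kl' => /(_ isT) h1 /(_ isT) h2.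
by case: (disj j j' (ins j) (ins j') jj em); lia.
Qed.

Lemma sched_completion j : completion m sched j = lookup j x.2 + p j.
Proof.
rewrite /completion /loop_completion /sched -addnA; congr (_ + _).
by rewrite /p -[in RHS](prednK (loops_gt0 j)) mulnS addnC.
Qed.

Lemma sched_cost : head 0 x.1 = \sum_j w j * completion m sched j.
Proof.
have [ts [-> _ _ _]] := cons; rewrite /= /schedule_cost (perm_big _ perm_s) /= big_enum /=.
by apply: eq_bigr => j _; rewrite sched_completion.
Qed.

End UpperBound.
End ScheduleBounds.

(** * Polynomial bounds *)

Section PolynomialBounds.

(** The single monomial s.+1 * K.+1 suffices as a scale, which makes closure under sums,
    products and constant powers immediate. *)
Definition polybounded (f : nat -> nat -> nat) :=
  exists c d, forall s K, f s K <= c * (s.+1 * K.+1) ^ d.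

Lemma polybounded_const c : polybounded (fun _ _ => c).
Proof. by exists c, 0 => s K; rewrite muln1. Qed.

Lemma polybounded_size : polybounded (fun s _ => s).
Proof. by exists 1, 1 => s K; rewrite mul1n expn1; apply: leq_trans (leqnSn s) _; apply: leq_pmulr. Qed.

Lemma polybounded_precision : polybounded (fun _ K => K).
Proof. by exists 1, 1 => s K; rewrite mul1n expn1; apply: leq_trans (leqnSn K) _; apply: leq_pmull. Qed.

Lemma polyboundedD f g : polybounded f -> polybounded g -> polybounded (fun s K => f s K + g s K).
Proof.
move=> [c [d hf]] [c' [d' hg]]; exists (c + c'), (d + d') => s K.
rewrite mulnDl; apply: leq_add.
  by apply: leq_trans (hf s K) _; rewrite leq_mul2l expnD leq_pmulr ?orbT // expn_gt0.
by apply: leq_trans (hg s K) _; rewrite leq_mul2l expnD leq_pmull ?orbT // expn_gt0.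
Qed.

Lemma polyboundedM f g : polybounded f -> polybounded g -> polybounded (fun s K => f s K * g s K).
Proof.
move=> [c [d hf]] [c' [d' hg]]; exists (c * c'), (d + d') => s K.
by rewrite expnD mulnACA leq_mul.
Qed.

Lemma polyboundedX f e : polybounded f -> polybounded (fun s K => f s K ^ e).
Proof.
move=> hf; elim: e => [|e IH]; first exact: polybounded_const.
have [c [d h]] := polyboundedM hf IH; exists c, d => s K; rewrite expnS; exact: h.
Qed.

Lemma polyboundedS f : polybounded f -> polybounded (fun s K => (f s K).+1).
Proof.
move=> hf; have [c [d h]] := polyboundedD hf (polybounded_const 1).
by exists c, d => s K; rewrite -addn1; apply: h.
Qed.

End PolynomialBounds.

Ltac polybound := lazymatch goal with
  | |- polybounded (fun _ _ => ?c) => exact: polybounded_const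
  | |- polybounded (fun s _ => s) => exact: polybounded_size
  | |- polybounded (fun _ K => K) => exact: polybounded_precision
  | |- polybounded (fun s K => S (@?f s K)) => apply: (@polyboundedS f); polybound
  | |- polybounded (fun s K => addn (@?f s K) (@?g s K)) => apply: (@polyboundedD f g); polybound
  | |- polybounded (fun s K => muln (@?f s K) (@?g s K)) => apply: (@polyboundedM f g); polybound
  | |- polybounded (fun s K => expn (@?f s K) ?e) => apply: (@polyboundedX f e); polybound
  end.

(** With s the input size, weights are at most 2^(2s), total lengths 2^(m + 2s) and costs
    2^(5s + m + 1); the comparisons multiply them by at most N + 1, whose bit length is
    generously bounded by s (K + 1) + 2. *)
Definition bits m s K := 5 * s + m + s * K.+1 + K + 10.
(** The bound of [antichain_size], with the number of jobs replaced by the input size. *)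
Definition front_bound m s K := ((s * K.+1 + 1) * bits m s K).+1 ^ m.+1.
Definition time_bound m s K := main_cost m (60 * bits m s K) s (front_bound m s K).

Lemma time_bound_poly m : polybounded (time_bound m).
Proof. by rewrite /time_bound /main_cost /front_bound /bits; polybound. Qed.

Lemma leq_main_cost m U Q n n' : n <= n' -> main_cost m U n Q <= main_cost m U n' Q.
Proof.
move=> le; rewrite /main_cost; apply: leq_add; last by rewrite leq_mul2r ltnS le orbT.
rewrite leq_mul2r leq_add2r; apply/orP; right.
have le2 : n.+2 <= n'.+2 by [].
have := leq_mul le2 le2; lia.
Qed.

(** * The program on an instance *)

Section Instance.
Variables (m K : nat) (I : rfs_inst).
Hypothesis m_gt0 : 0 < m.
Notation J := 'I_(njobs I).
Definition num (j : J) := absz (numq (weight j)).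
Definition den (j : J) := absz (denq (weight j)).
Definition common_den := \prod_(j <- enum J) den j.
(** The weights times the product of all denominators: integers with the same optimal
    schedules and the same approximation ratios. *)
Definition wt (j : J) := num j * (common_den %/ den j).
Definition len (j : J) := m * loops j.
Notation key := (@nat_of_ord (njobs I)).
Let s := vsize (rfs_enc_inst I).
Let n := njobs I.
Let B := bits m s K.

Lemma den_gt0 j : 0 < den j.
Proof. by rewrite absz_gt0 denq_eq0. Qed.

Lemma vsize_enc_seq (T : Type) (f : T -> val) l :
  vsize (enc_seq (map f l)) = \sum_(j <- l) (vsize (f j)).+1 + 1.
Proof.
elim: l => [|j l IH]; first by rewrite big_nil.
by rewrite big_cons -addnA -IH /= addSn.
Qed.

Lemma input_size : \sum_(j : J) (bitlen (@loops I j) + bitlen (num j) + bitlen (den j) + 1) <= s.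
Proof.
rewrite /s /rfs_enc_inst vsize_enc_seq big_enum /=.
by apply: leq_trans (leq_addr _ _); apply: leq_sum => j _; rewrite /num /den; lia.
Qed.

Lemma input_bits (j : J) : bitlen (loops j) + bitlen (num j) + bitlen (den j) <= s.
Proof.
apply: leq_trans input_size; rewrite (bigD1 j) //=; lia.
Qed.

Lemma njobs_le : n <= s.
Proof.
apply: leq_trans input_size; rewrite -[n]card_ord -sum1_card.
by apply: leq_sum => j _; rewrite addn1.
Qed.

Lemma lt_pow2 a e : bitlen a <= e -> a < 2 ^ e.
Proof. by move=> le; apply: leq_trans (ltn_2bitlen a) _; rewrite leq_exp2l. Qed.

Lemma loops_lt (j : J) : loops j < 2 ^ s.
Proof. by apply: lt_pow2; have := input_bits j; lia. Qed.

Lemma num_lt j : num j < 2 ^ s.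
Proof. by apply: lt_pow2; have := input_bits j; lia. Qed.

Lemma den_lt j : den j < 2 ^ s.
Proof. by apply: lt_pow2; have := input_bits j; lia. Qed.

Lemma common_den_le : common_den <= 2 ^ s.
Proof.
apply: leq_trans (_ : \prod_(j <- enum J) 2 ^ bitlen (den j) <= _).
  by apply: leq_prod => j _; apply/ltnW/ltn_2bitlen.
rewrite -expn_sum leq_exp2l // big_enum /=.
by apply: leq_trans input_size; apply: leq_sum => j _; lia.
Qed.

Lemma common_den_gt0 : 0 < common_den.
Proof. by rewrite /common_den; elim/big_ind: _ => // [a b a0 b0|j _]; rewrite ?muln_gt0 ?a0 ?den_gt0. Qed.

Lemma wt_le j : wt j <= 2 ^ (2 * s).
Proof.
rewrite mul2n -addnn expnD leq_mul ?(ltnW (num_lt j)) //.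
exact: leq_trans (leq_div _ _) common_den_le.
Qed.

Lemma len_le j : len j <= 2 ^ (m + s).
Proof. by rewrite expnD leq_mul ?(ltnW (loops_lt j)) // ltnW // ltn_expl. Qed.

Lemma sum_le (t : seq J) (F : J -> nat) M : uniq t -> {in t, forall j, F j <= M} ->
  \sum_(j <- t) F j <= 2 ^ s * M.
Proof.
move=> ut le; rewrite big_seq.
apply: leq_trans (_ : \sum_(j <- t | j \in t) M <= _); first exact: leq_sum.
rewrite -big_seq big_const_seq count_predT iter_addn_0 mulnC leq_mul2r; apply/orP; right.
have st : size t <= n by rewrite -[n]card_ord -(card_uniqP ut) max_card.
by apply: leq_trans st (leq_trans njobs_le _); apply/ltnW/ltn_expl.
Qed.

Notation small := (small B).

Lemma B_pos : 0 < B.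
Proof. by rewrite /B /bits; lia. Qed.

Lemma small_pow a e : a <= 2 ^ e -> e < B -> small a.
Proof.
move=> le lt; apply: bitlen_le B_pos; apply: leq_ltn_trans le _; by rewrite ltn_exp2l.
Qed.

(** The N of [dominates], chosen for [ratio_pow_le]. *)
Definition precision := n * K.+1 + 1.

Lemma precision_le : precision.+1 <= 2 ^ (s * K.+1 + 2).
Proof.
apply: leq_trans (_ : s * K.+1 + 2 <= _); last exact/ltnW/ltn_expl.
by rewrite /precision -addnS leq_add2r leq_mul2r njobs_le orbT.
Qed.

Lemma consistent_entries t x : uniq t -> consistent wt len key m t x ->
  all (fun a => a <= 2 ^ (5 * s + m + 1)) x.1.
Proof.
move=> ut [ts [-> szt tb [_ kend _]]].
have le_ts a : a \in ts -> a <= 2 ^ (2 * s + m + 1).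
  move=> /(nthP 0) [r]; rewrite szt => rm <-; have [_ le] := tb r rm.
  apply: leq_trans le _; apply: leq_trans (_ : 2 ^ (2 * s + m) + 2 ^ (2 * s + m) <= _).
    apply: leq_add.
      apply: leq_trans (ltnW rm) _; apply: leq_trans (ltnW (ltn_expl m (ltnSn 1))) _.
      by rewrite leq_exp2l // leq_addl.
    apply: leq_trans (sum_le ut (M := 2 ^ (m + s)) _) _ => [j _|]; first exact: len_le.
    by rewrite -expnD leq_exp2l //; lia.
  by rewrite [X in _ <= X]expnD expn1 muln2 -addnn.
rewrite /= ; apply/andP; split; last first.
  by apply/allP => a /le_ts /leq_trans; apply; rewrite leq_exp2l //; lia.
apply: leq_trans (sum_le ut (M := 2 ^ (2 * s) * 2 ^ (2 * s + m + 1)) _) _ => [j jt|].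
  apply: leq_mul (wt_le j) _; apply: leq_trans (kend j jt) (le_ts _ _).
  by apply: mem_nth; rewrite szt ltn_mod.
by rewrite -!expnD leq_exp2l //; lia.
Qed.

Lemma consistent_small t x : uniq t -> consistent wt len key m t x -> ok m B precision x.1.
Proof.
move=> ut cx; have [ts [e szt _ _]] := cx.
apply/andP; split; first by rewrite e /= szt.
apply: sub_all (consistent_entries ut cx) => a le.
apply: (@small_pow _ (s * K.+1 + 2 + (5 * s + m + 1))).
  by rewrite expnD leq_mul // precision_le.
by rewrite /B /bits; lia.
Qed.

Lemma antichain_bound V : all (ok m B precision) V ->
  pairwise (fun u v => ~~ dominates precision v u) V -> size V <= front_bound m s K.
Proof.
move=> okV aV; have N0 : 0 < precision by rewrite /precision addn1.
apply: leq_trans (antichain_size (b := B) N0 (q := m.+1) _ aV) _.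
  apply: sub_all okV => v /andP [-> av] /=; apply: sub_all av => a sa.
  apply: lt_pow2; apply: small_le sa; exact: leq_pmull.
by rewrite leq_exp2r // ltnS leq_mul2r leq_add2r leq_mul2r njobs_le !orbT.
Qed.

Let order := isort wt len (enum J).
Let final := dp wt len key m precision order [:: init_state m].

Lemma program_runs : exists x X, final = x :: X /\ exists y t,
  [/\ runs (prog m K) (rfs_enc_inst I) y t,
      y = Pair (Num 1) (enc_nats [seq lookup k (best X x).2 | k <- iota 0 n])
    & t <= time_bound m s K].
Proof.
have le_small a e : a <= 2 ^ e -> e <= 5 * s + m + s * K.+1 + K + 9 -> small a.
  by move=> le le'; apply: small_pow le _; rewrite /B /bits; lia.
have e1 : 2 * s + (m + s) <= 5 * s + m + s * K.+1 + K + 9 by lia.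
have small_m : small m by apply: (@le_small _ m); [apply/ltnW/ltn_expl | lia].
have small_p j : small (len j) by apply: le_small (len_le j) _; lia.
have small_w j : small (wt j) by apply: le_small (wt_le j) _; lia.
have small_wp i j : small (wt i * len j).
  by apply: (@le_small _ (2 * s + (m + s))) => //; rewrite expnD leq_mul ?wt_le ?len_le.
have small_njobs : small n.
  by apply: (@le_small _ s); [apply: leq_trans njobs_le _; apply/ltnW/ltn_expl | lia].
have small_key j : small (key j) by apply: small_le small_njobs; apply/ltnW/ltn_ord.
have small_loops j : small (@loops I j) by apply: le_small (ltnW (loops_lt j)) _; lia.
have small_num j : small (num j) by apply: le_small (ltnW (num_lt j)) _; lia.
have small_den j : small (den j) by apply: le_small (ltnW (den_lt j)) _; lia.
have small_D : small common_den by apply: le_small common_den_le _; lia.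
have small_K : small K.+1 by apply: (@le_small _ K.+1); [apply/ltnW/ltn_expl | lia].
have small_N1 : small precision.+1 by apply: le_small precision_le _; lia.
have size_jobs : size (enum J) = n by rewrite size_enum_ord.
have keys : map key (enum J) = iota 0 (size (enum J)) by rewrite val_enum_ord size_jobs.
have := main_ok (leqnn (60 * B)) small_m small_p small_w small_wp small_key small_loops small_num
  small_den den_gt0 (@ord_inj n) m_gt0 (enum_uniq _) keys (fun=> erefl) (fun=> erefl).
rewrite size_jobs => main.
have [x [X [eX [y [t [rt ey tb]]]]]] :=
  main K _ small_njobs small_K small_D small_N1 antichain_bound consistent_small.
exists x, X; split=> //; exists y, t; split=> //.
exact: leq_trans tb (leq_main_cost _ _ _ njobs_le).
Qed.

Definition assignment_cost (f : {ffun J -> 'I_m}) :=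
  \sum_(r < m) wct wt len r [seq j <- order | f j == r].

Lemma order_smith : pairwise (smith wt len) order.
Proof. by apply: pairwise_isort => j; apply: p_gt0. Qed.

Lemma perm_order : perm_eq order (enum J).
Proof. exact: perm_isort. Qed.

Lemma size_order : size order = n.
Proof. by rewrite (perm_size perm_order) size_enum_ord. Qed.

Lemma weightE (j : J) : weight j = ((num j)%:R / (den j)%:R)%R.
Proof.
rewrite -[LHS]divq_num_den /num /den; congr (_ / _)%R.
  by rewrite pmulrn gez0_abs // numq_ge0 ltW // weight_gt0.
by rewrite pmulrn gez0_abs // denq_ge0.
Qed.

Lemma weight_wt (j : J) : (weight j * common_den%:R)%R = (wt j)%:R%R.
Proof.
have dj : den j %| common_den by rewrite /common_den (big_rem j) ?mem_enum //= dvdn_mulr.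
have d0 : ((den j)%:R != 0 :> rat)%R by rewrite pnatr_eq0 -lt0n den_gt0.
by rewrite /wt weightE -{1}(divnK dj) !natrM [X in (_ * X)%R]mulrC mulrA divfK.
Qed.

Lemma objectiveE (S : schedule I) :
  rfs_objective m S = ((\sum_j wt j * completion m S j)%:R / common_den%:R)%R.
Proof.
have Dn0 : (common_den%:R != 0 :> rat)%R by rewrite pnatr_eq0 -lt0n common_den_gt0.
rewrite /rfs_objective natr_sum mulr_suml; apply: eq_bigr => j _.
by rewrite natrM -weight_wt mulrAC mulfK.
Qed.

Lemma len_mod j : len j = 0 %[mod m].
Proof. by rewrite mod0n modnMr. Qed.

(** The cheapest assignment is optimal among all schedules of the shop: it is realized
    by a schedule, and each schedule costs at least as much as some assignment. *)
Lemma optimum_exists : exists f : {ffun J -> 'I_m},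
  is_optimum (pb := reentrant_flow_shop m) I ((assignment_cost f)%:R / common_den%:R)%R.
Proof.
have D0 : (0 < common_den%:R :> rat)%R by rewrite ltr0n common_den_gt0.
have [f fmin] : exists f : {ffun J -> 'I_m}, forall g, assignment_cost f <= assignment_cost g.
  pose f0 : {ffun J -> 'I_m} := [ffun=> Ordinal m_gt0].
  by case: (@arg_minnP _ f0 xpredT assignment_cost isT) => f _ fmin; exists f => g; apply: fmin.
exists f; split.
  have us : uniq order by rewrite (perm_uniq perm_order) enum_uniq.
  have cons : consistent wt len key m order (follow wt len key (fun j => f j) order (init_state m)).
    by apply: consistent_follow => //; [exact: ord_inj | exact: len_mod].
  exists (sched m (follow wt len key (fun j => f j) order (init_state m))).
    exact: sched_feasible perm_order cons.
  rewrite /= objectiveE; congr (_%:R / _)%R.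
  rewrite -(sched_cost perm_order cons) //.
  rewrite follow_cost /= ?size_iota // add0n; apply: eq_bigr => r _.
  by rewrite nth_iota.
move=> S feas; have [g le] := schedule_ge_assignment m_gt0 feas order_smith perm_order.
rewrite /= objectiveE ler_pM2r ?invr_gt0 // ler_nat.
by apply: leq_trans le; apply: fmin.
Qed.

Lemma approximate_run : 0 < K -> exists y t (S : schedule I) f,
  [/\ runs (prog m K) (rfs_enc_inst I) y t, t <= time_bound m s K,
      rfs_enc_sol m S y /\ rfs_feasible m S,
      is_optimum (pb := reentrant_flow_shop m) I ((assignment_cost f)%:R / common_den%:R)%R
    & exists2 z, rfs_objective m S = (z%:R / common_den%:R)%R & K * z <= K.+1 * assignment_cost f].
Proof.
move=> K0; have [f opt] := optimum_exists.
have [x [X [eX [y [t [rt ey tb]]]]]] := program_runs.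
have us : uniq order by rewrite (perm_uniq perm_order) enum_uniq.
have cons : consistent wt len key m order (best X x).
  apply: (@dp_consistent J wt len key m (@ord_inj n) m_gt0 len_mod precision [::] order [:: init_state m]) => //.
    by move=> u; rewrite inE => /eqP ->; apply: consistent_init.
  by rewrite -/final eX; apply: best_mem.
exists y, t, (sched m (best X x)), f; split=> //.
  split; last exact: sched_feasible perm_order cons.
  rewrite ey.
  have -> : enc_nats [seq lookup k (best X x).2 | k <- iota 0 n] =
      enc_seq [seq Num (sched m (best X x) j 1) | j <- enum J].
    rewrite /enc_nats -val_enum_ord -!map_comp; congr enc_seq.
    by apply: eq_map => j /=; rewrite /sched muln0 addn0.
  by apply: EncCompact; apply: sched_uninterrupted.
exists (head 0 (best X x).1); first by rewrite objectiveE -(sched_cost perm_order cons).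
have := dp_near_optimal f eX; rewrite size_order => near.
have N0 : 0 < precision ^ n by rewrite expn_gt0 /precision addn1.
have ratio : precision.+1 ^ n * K <= K.+1 * precision ^ n.
  by apply: ratio_pow_le; rewrite /precision ?addn1 // leqnSn.
rewrite -(leq_pmul2l N0) mulnCA.
apply: leq_trans (_ : K * (precision.+1 ^ n * assignment_cost f) <= _).
  by rewrite leq_mul2l near orbT.
by rewrite !mulnA leq_mul2r mulnC [_ ^ n * K.+1]mulnC ratio orbT.
Qed.

End Instance.

(** * The approximation scheme *)

Theorem theorem5p5 (R : realType) (m : nat) (hm : 0 < m) :
  has_fptas R (reentrant_flow_shop m).
Proof.
have [c [d bound]] := time_bound_poly m.
exists (c%:R%:P%:P * (('X + 1%:P%:P) * ('X + 2%:P)%:P) ^+ d)%R => eps eps0.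
(* 1 / eps < K <= 1 / eps + 1: the ratio 1 + 1/K is good enough, and a polynomial in K is
   bounded by one in 1 / eps. *)
pose K := (Num.truncn (eps^-1)%R).+1.
have ie0 : (0 <= eps^-1)%R by rewrite invr_ge0 ltW.
have Kgt : (eps^-1 < K%:R :> R)%R by exact: truncnS_gt.
have Kle : (K%:R <= eps^-1 + 1 :> R)%R by rewrite -[K]addn1 natrD lerD2r truncn_le.
exists (prog m K) => I.
have [y [t [S [f [rt tb es opt [z ez zle]]]]]] := approximate_run I hm (ltn0Sn _ : 0 < K).
exists y, t, S, ((assignment_cost f)%:R / (common_den I)%:R)%R; split=> //.
  apply: le_trans (_ : ((c * ((vsize (rfs_enc_inst I)).+1 * K.+1) ^ d)%:R <= _)%R).
    by rewrite ler_nat; apply: leq_trans tb (bound _ _).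
  rewrite !(hornerM, horner_exp, hornerD, hornerX, hornerC) natrM natrX natrM.
  have ? := ler0n R (vsize (rfs_enc_inst I)).
  apply: ler_wpM2l => //; apply: lerXn2r; rewrite ?nnegrE ?mulr_ge0 //; [lra..|].
  by rewrite -[_.+1]addn1 -[K.+1]addn1 !natrD; nra.
have D0 : (0 < (common_den I)%:R :> R)%R by rewrite ltr0n common_den_gt0.
rewrite /= ez !fmorph_div /= !ratr_nat mulrA ler_pM2r ?invr_gt0 //.
have K0 : (0 < K%:R :> R)%R by rewrite ltr0n.
rewrite -(ler_pM2l K0); apply: le_trans (_ : ((K.+1 * assignment_cost f)%:R <= _)%R).
  by rewrite -natrM ler_nat.
rewrite natrM mulrA ler_wpM2r // mulrDr mulr1 -[K.+1]addn1 natrD lerD2l.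
by rewrite -ler_pdivrMr // div1r ltW.
Qed.
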